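(* Let $\mathcal H$ and $\hat{\mathcal H}$ be compact self-adjoint operators with non-negative eigenvalues on a separable real Hilbert space $\mathbb H$, and let $J$ be a finite index set with spectral gap $\gamma_J>0$ (all notation as defined in the context). If $\hat\alpha_J\le1/4$, then for every $c\in\mathbb R$, $$\begin{aligned}&\Big\|(\hat\lambda_k-c)_{k\in J}-\mathrm{spec}_\downarrow\big(\langle(\hat{\mathcal H}-\mathcal H)\psi_k,\psi_\ell\rangle\big)_{k,\ell\in J}\Big\|_2\\&\quad\le\min\Big\{\Big(\Big(\tfrac{56\sqrt{2D}}{9}\hat\alpha_J+4\Big)\gamma_J+\tfrac{56(\sqrt2+1)\sqrt D}{9}\max_{1\le d\le D}|\theta_d-c|\Big)\hat\alpha_J\hat\beta_J,\\&\qquad\qquad\Big((3+\sqrt2)\gamma_J+(4\sqrt2+4)\max_{1\le d\le D}|\theta_d-c|\Big)\hat\beta_J^2\Big\}+\big\|(\lambda_k-c)_{k\in J}\big\|_2 .\end{aligned}$$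
   Context: $\mathbb H$ is a separable real Hilbert space with inner product $\langle\cdot,\cdot\rangle$; $\|\cdot\|_{\mathrm{op}}$ and $\|\cdot\|_{\mathrm{HS}}$ are the operator and Hilbert–Schmidt norms; $\|\cdot\|_2$ is the Euclidean norm; $(u\otimes v)w=\langle v,w\rangle u$. $\mathcal H,\hat{\mathcal H}$ are compact self-adjoint operators on $\mathbb H$ whose eigenvalues are all non-negative. Write $\mathcal H=\sum_{k}\lambda_k\mathcal Q_k$, $\mathcal Q_k=\psi_k\otimes\psi_k$, with $\lambda_1\ge\lambda_2\ge\dots\ge0$ (repeated according to multiplicity) and orthonormal eigenvectors $\psi_k$; similarly $\hat{\mathcal H}=\sum_k\hat\lambda_k\hat{\mathcal Q}_k$, $\hat{\mathcal Q}_k=\hat\psi_k\otimes\hat\psi_k$, $\hat\lambda_1\ge\hat\lambda_2\ge\dots\ge0$. Both eigenvector systems are understood to be complete, $\sum_k\mathcal Q_k=\sum_k\hat{\mathcal Q}_k=$ identity: if the ordered sequence misses part of the kernel, an orthonormal basis of the remaining part of the kernel is adjoined with eigenvalue $0$, and is included in all sums over indices not in $J$. $J\subset\mathbb N$ is a finite nonempty index set (ordered increasingly) with $\gamma_J:=\min_{k\in J,\ell\notin J}|\lambda_k-\lambda_\ell|>0$. The distinct values among $\{\lambda_k\}_{k\in J}$ are $\theta_1>\dots>\theta_D$. $\mathcal P_J=\sum_{k\in J}\mathcal Q_k$. Weighted perturbation quantities: with $$|\mathcal R|_J^{1/2}=\sum_{k\notin J}\frac{\mathcal Q_k}{\sqrt{\min_{m\in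 J}|\lambda_k-\lambda_m|}},\qquad \mathcal T_J^{1/2}=\frac{1}{\sqrt{\gamma_J}}\mathcal P_J+|\mathcal R|_J^{1/2},$$ set $\hat\alpha_J=\|\mathcal T_J^{1/2}(\hat{\mathcal H}-\mathcal H)\mathcal T_J^{1/2}\|_{\mathrm{op}}$ and $\hat\beta_J=\gamma_J^{-1/2}\||\mathcal R|_J^{1/2}(\hat{\mathcal H}-\mathcal H)\mathcal P_J\|_{\mathrm{HS}}$. $\mathrm{spec}_\downarrow(A)$ is the vector of eigenvalues of a square matrix $A$ in non-increasing order, with multiplicity. *)

(* Defs.v *)
From HB Require Import structures.
From mathcomp Require Import all_boot all_order all_algebra.
From mathcomp Require Import all_classical all_reals all_analysis.
From mathcomp.analysis Require showcase.summability.

Set Implicit Arguments.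
Unset Strict Implicit.
Unset Printing Implicit Defensive.
Import Order.TTheory GRing.Theory Num.Theory numFieldNormedType.Exports.

Local Open Scope classical_set_scope.
Local Open Scope ring_scope.

(* A real Hilbert space is a [completeNormedModType R] H together with a
   symmetric positive definite form [ip : {dot H for idfun}] whose induced norm
   is the norm of H. *)
Definition norm_from (R : realType) (H : completeNormedModType R)
    (ip : {dot H for idfun}) : Prop :=
  forall x : H, `|x| ^+ 2 = ip x x.

Definition separable_space (T : topologicalType) : Prop :=
  exists2 B : set T, countable B & dense B.

Definition compact_operator (R : realType) (H : completeNormedModType R)
    (A : {linear H -> H}) : Prop :=
  precompact [set A x | x in [set x : H | `|x| <= 1]].

Definition selfadjoint (R : realType) (H : completeNormedModType R)
    (ip : {dot H for idfun}) (A : {linear H -> H}) : Prop :=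
  forall x y : H, ip (A x) y = ip x (A y).

Definition nonneg_eigenvalues (R : realType) (H : completeNormedModType R)
    (A : {linear H -> H}) : Prop :=
  forall (a : R) (x : H), x != 0 -> A x = a *: x -> 0 <= a.

(* The supremum is the operator norm when A is bounded ([sup] of an unbounded
   set is 0). *)
Definition opnorm (R : realType) (H : completeNormedModType R) (A : H -> H) : R :=
  sup [set `|A x| | x in [set x : H | `|x| <= 1]].

(* (u (x) v) w = <v, w> u *)
Definition tensor (R : realType) (H : completeNormedModType R)
    (ip : {dot H for idfun}) (u v : H) : H -> H :=
  fun w => ip v w *: u.

(* [inl k] is the k-th term (counted from 0) of the ordered sequence of
   eigenvalues and eigenvectors; [inr k] is the k-th vector adjoined to complete
   the eigenvectors. Only the indices in [idx] are actually present. *)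
Record eigensystem (R : realType) (H : completeNormedModType R) := Eigensystem {
  idx : set (nat + nat);
  eigval : nat + nat -> R;
  eigvec : nat + nat -> H }.

(* The projection Q_i, taken to be 0 when the index i is absent. *)
Definition eigproj (R : realType) (H : completeNormedModType R)
    (ip : {dot H for idfun}) (S : eigensystem H) (i : nat + nat) : H -> H :=
  if i \in idx S then tensor ip (eigvec S i) (eigvec S i) else fun=> 0.

(* Complete orthonormal system of eigenvectors of A. Present ordered indices
   form an initial segment of nat (all of nat, or finite), along which the
   eigenvalues are nonincreasing; the adjoined vectors lie in the kernel. The
   identity sum_i Q_i = id is unconditional strong convergence. *)
Definition eigensystem_of (R : realType) (H : completeNormedModType R)
    (ip : {dot H for idfun}) (A : {linear H -> H}) (S : eigensystem H) : Prop :=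
  [/\ forall k l, (k <= l)%N -> idx S (inl l) ->
        idx S (inl k) /\ eigval S (inl l) <= eigval S (inl k),
      forall k, idx S (inr k) -> eigval S (inr k) = 0,
      forall i j, idx S i -> idx S j ->
        ip (eigvec S i) (eigvec S j) = (i == j)%:R,
      forall i, idx S i -> A (eigvec S i) = eigval S i *: eigvec S i
    & forall x : H,
        summability.partial_sum (fun i => eigproj ip S i x)
          @ summability.totally --> x].

(* Below, a finite set of indices J of the ordered sequence is represented by
   its increasing enumeration. *)

Definition outside (R : realType) (H : completeNormedModType R)
    (S : eigensystem H) (J : seq nat) : set (nat + nat) :=
  idx S `\` [set inl k | k in [set` J]].

(* min_(m in J) |lambda_i - lambda_m| *)
Definition dist_to (R : realType) (H : completeNormedModType R)
    (S : eigensystem H) (J : seq nat) (i : nat + nat) : R :=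
  let d (m : nat) := `|eigval S i - eigval S (inl m)| in
  \big[Num.min/d (head 0%N J)]_(m <- J) d m.

(* For the eigenvalues of a compact operator the infimum is attained as soon as
   it is positive, so that gap S J > 0 makes it a minimum; if no index lies
   outside J the infimum is 0. *)
Definition gap (R : realType) (H : completeNormedModType R)
    (S : eigensystem H) (J : seq nat) : R :=
  inf [set `|eigval S (inl k) - eigval S l| |
        k in [set` J] & l in outside S J].

Definition specproj (R : realType) (H : completeNormedModType R)
    (ip : {dot H for idfun}) (S : eigensystem H) (J : seq nat) : H -> H :=
  fun x => \sum_(k <- J) eigproj ip S (inl k) x.

(* |R|_J^{1/2}, the sum being taken in the strong sense *)
Definition absR_half (R : realType) (H : completeNormedModType R)
    (ip : {dot H for idfun}) (S : eigensystem H) (J : seq nat) : H -> H :=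
  fun x => summability.sum (fun i : nat + nat =>
    if i \in outside S J
    then (Num.sqrt (dist_to S J i))^-1 *: eigproj ip S i x else 0).

Definition T_half (R : realType) (H : completeNormedModType R)
    (ip : {dot H for idfun}) (S : eigensystem H) (J : seq nat) : H -> H :=
  fun x => (Num.sqrt (gap S J))^-1 *: specproj ip S J x + absR_half ip S J x.

(* Hilbert-Schmidt norm, computed in the orthonormal basis S *)
Definition hsnorm (R : realType) (H : completeNormedModType R)
    (S : eigensystem H) (A : H -> H) : R :=
  Num.sqrt (fine (esum (idx S) (fun i => (`|A (eigvec S i)| ^+ 2)%:E))).

Definition alphaJ (R : realType) (H : completeNormedModType R)
    (ip : {dot H for idfun}) (A Ah : {linear H -> H}) (S : eigensystem H)
    (J : seq nat) : R :=
  opnorm (T_half ip S J \o (Ah \- A) \o T_half ip S J).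

Definition betaJ (R : realType) (H : completeNormedModType R)
    (ip : {dot H for idfun}) (A Ah : {linear H -> H}) (S : eigensystem H)
    (J : seq nat) : R :=
  (Num.sqrt (gap S J))^-1 *
  hsnorm S (absR_half ip S J \o (Ah \- A) \o specproj ip S J).

(* The distinct values theta_1 > ... > theta_D of lambda on J *)
Definition distinct_eigvals (R : realType) (H : completeNormedModType R)
    (S : eigensystem H) (J : seq nat) : seq R :=
  sort >=%R (undup [seq eigval S (inl k) | k <- J]).

(* max_(1 <= d <= D) |theta_d - c| *)
Definition max_dev (R : realType) (H : completeNormedModType R)
    (S : eigensystem H) (J : seq nat) (c : R) : R :=
  \big[Num.max/0]_(t <- distinct_eigvals S J) `|t - c|.

Definition compression (R : realType) (H : completeNormedModType R)
    (ip : {dot H for idfun}) (B : H -> H) (S : eigensystem H) (J : seq nat) :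
    'M[R]_(size J) :=
  \matrix_(a, b) ip (B (eigvec S (inl (nth 0%N J a))))
                    (eigvec S (inl (nth 0%N J b))).

(* The eigenvalues of M in nonincreasing order, with (algebraic) multiplicity;
   this specifies a unique tuple when the characteristic polynomial splits over
   R, in particular when M is symmetric. *)
Definition spec_down (R : realType) (n : nat) (M : 'M[R]_n) : 'rV[R]_n :=
  let s := xget (nseq_tuple n 0)
    [set s : n.-tuple R |
      sorted >=%R s /\ char_poly M = \prod_(a <- s) ('X - a%:P)] in
  \row_i tnth s i.

Definition norm2 (R : realType) (n : nat) (v : 'rV[R]_n) : R :=
  Num.sqrt (\sum_i v 0 i ^+ 2).

(* (lambda_k - c)_(k in J) *)
Definition shifted_eigvals (R : realType) (H : completeNormedModType R)
    (S : eigensystem H) (J : seq nat) (c : R) : 'rV[R]_(size J) :=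
  \row_a (eigval S (inl (nth 0%N J a)) - c).

(* Main.v *)
Require Import Defs.
From HB Require Import structures.
From mathcomp Require Import all_boot all_order all_algebra.
From mathcomp Require Import all_classical all_reals all_analysis.
From mathcomp Require Import finmap perm ring lra.
From mathcomp.analysis Require showcase.summability.
From mathcomp Require complex.
Set Implicit Arguments.
Unset Strict Implicit.
Unset Printing Implicit Defensive.
Import Order.TTheory GRing.Theory Num.Theory numFieldNormedType.Exports.

Local Open Scope classical_set_scope.
Local Open Scope ring_scope.

(** Write E for the perturbation, P for the projection onto the span of the
    eigenvectors psi_k with k in J, Q for its complement, N for the matrix of the
    compression of E to that span, Lam and Lamh for the diagonal matrices of the
    unperturbed and perturbed eigenvalues indexed by J, and K for the square matrix
    of the inner products of psi_j with the perturbed eigenvectors psih_k.  Write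
    al, be, g, m and D for alpha, beta, the gap, max |theta_d - c| and the number of
    distinct eigenvalues.

    If K were orthogonal and intertwined Lam + N with Lamh, the compression of the
    perturbed operator would have the spectrum Lamh exactly, and the theorem would be
    the Hoffman-Wielandt inequality applied to Lamh - c and N, whose difference is
    Lam - c after conjugation.  Both properties hold up to second order:

    - the residual K Lamh - (Lam + N) K has entries <E psi_j, Q psih_k>, and
    - the defect 1 - K^T K is the Gram matrix of the vectors Q psih_k.

    An orthogonal matrix at distance at most the defect from K always exists
    ([nearest_orthogonal], even for singular K), so replacing K by it costs
    2 (m + al g) times the defect in Frobenius norm, because both (Lam - c) + N and
    Lamh - c have norm at most m + al g ([eigenvalues_near_compression]).

    It remains to bound the vectors Q psih_k.  The operator T^{1/2} commutes with the
    unperturbed operator, so the definition of al says that the form of E is dominated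
    by al T^{-1}, T^{-1} being diagonal in the eigenvectors psi with values g on J and
    the distance to the eigenvalues of J off J ([form_le_alphaJ]).  Comparing quadratic
    forms by min-max gives |lamh_k - lam_k| <= al g for k in J ([weyl]); hence
    lamh_k stays at distance at least (1 - al) dist(lam_l) from every lam_l outside
    J, and the eigenvector equation for psih_k, read in the weighted norm, bounds
    Q psih_k by the first order term of be ([Q_eigvec_bound]).  Summing over k, the
    residual is at most 2 g be min(al, be) and the defect at most 4 be^2.

    For the bound in al be the defect is also at most 2 tau be, where tau bounds Q on
    the span of the psih_k.  Trivially tau = 1 works.  On the span of the psih_k
    belonging to one and the same theta_d the resolvent at theta_d gives (8/3) al
    ([Q_cluster_bound]), and the D pieces, being orthogonal before Q is applied, add up
    to tau = (8/3) al sqrt D.  Taking the first value when al sqrt D >= 3/8 and the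
    second otherwise is enough for the stated constants. *)

(** * The Cauchy-Schwarz inequality for finite sums *)

Lemma sum_CauchySchwarz (R : realFieldType) (I : finType) (a b : I -> R) :
  (\sum_i a i * b i) ^+ 2 <= (\sum_i a i ^+ 2) * (\sum_i b i ^+ 2).
Proof.
have dbl (f g : I -> R) :
    (\sum_i f i) * (\sum_i g i) = \sum_i \sum_j f i * g j.
  by rewrite mulr_suml; apply: eq_bigr => i _; rewrite mulr_sumr.
have : 0 <= \sum_i \sum_j (a i * b j - a j * b i) ^+ 2.
  by apply: sumr_ge0 => i _; apply: sumr_ge0 => j _; exact: sqr_ge0.
rewrite (_ : \sum_i _ = 2 * ((\sum_i a i ^+ 2) * (\sum_i b i ^+ 2)
    - (\sum_i a i * b i) ^+ 2)); first by lra.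
rewrite mulrBr expr2 !dbl mulr2n mulrDl !mul1r.
rewrite [X in _ = _ + X - _]exchange_big /= -big_split mulr_sumr -sumrB /=.
apply: eq_bigr => i _; rewrite -big_split mulr_sumr -sumrB /=.
by apply: eq_bigr => j _; ring.
Qed.

(** * Real symmetric matrices are orthogonally diagonalizable *)

Section EigenvectorInComplement.
Variable C : closedFieldType.

(** The characteristic polynomial of N splits and kills w; applying its linear
    factors to w one after the other, the last nonzero vector obtained is an
    eigenvector.  The relation [N *m B = B *m X] makes the kernel of B stable, so
    that none of these vectors leaves it. *)
Lemma stable_eigenvector n m (N : 'M[C]_n) (B : 'M[C]_(n, m)) (X : 'M[C]_m)
    (w : 'rV[C]_n) :
  N *m B = B *m X -> w != 0 -> w *m B = 0 ->
  exists v : 'rV[C]_n, exists2 z, v != 0 /\ v *m B = 0 & v *m N = z *: v.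
Proof.
case: n N B w => [N B w|n N B w NB].
  by rewrite [w]thinmx0 eqxx.
have [r rE] := closed_field_poly_normal (char_poly N).
have := Cayley_Hamilton N.
rewrite rE (monicP (char_poly_monic N)) scale1r rmorph_prod /= => r0 w0 wB.
have {r0} : w *m (\prod_(z <- r) horner_mx N ('X - z%:P)) = 0.
  by rewrite r0 mulmx0.
elim: r w w0 wB {rE} => [|z r IH] w w0 wB.
  by rewrite big_nil mulmx1 => w00; rewrite w00 eqxx in w0.
rewrite big_cons /= -mulmxE mulmxA rmorphB /= horner_mx_X horner_mx_C.
have [wz _|wz] := eqVneq (w *m (N - z%:M)) 0.
  exists w, z => //; apply/eqP; rewrite -subr_eq0 -wz mulmxBr.
  by rewrite mul_mx_scalar.
apply: IH => //.
by rewrite -mulmxA mulmxBl NB mulmxBr !mulmxA wB mul0mx sub0r -mulmxA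
  mul_scalar_mx -scalemxAr wB scaler0 oppr0.
Qed.

End EigenvectorInComplement.

Section RealSpectral.
Variable R : rcfType.
Import complex.

(** The eigenvalue found over the complex numbers is real because N is symmetric; the
    real part or the imaginary part of the eigenvector is then a real one. *)
Lemma sym_eigenvector_in_complement n m (N : 'M[R]_n) (B : 'M[R]_(n, m)) X
    (w : 'rV[R]_n) :
  N^T = N -> N *m B = B *m X -> w != 0 -> w *m B = 0 ->
  exists v : 'rV[R]_n, exists2 z, v != 0 /\ v *m B = 0 & v *m N = z *: v.
Proof.
move=> Nsym NB w0 wB.
pose f : {rmorphism R -> complex R} := real_complex R.
have NB' : map_mx f N *m map_mx f B = map_mx f B *m map_mx f X.
  by rewrite -!map_mxM NB.
have w0' : map_mx f w != 0 by rewrite map_mx_eq0.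
have wB' : map_mx f w *m map_mx f B = 0 by rewrite -map_mxM wB map_mx0.
have [v [z [v0 vB] vN]] := stable_eigenvector NB' w0' wB'.
pose a := map_mx (@Re R) v; pose b := map_mx (@Im R) v.
have vE : forall j, v 0 j = Complex (a 0 j) (b 0 j).
  by move=> j; rewrite !mxE; case: (v 0 j).
have part p (G : 'M[R]_(n, p)) j : (v *m map_mx f G) 0 j =
    Complex ((a *m G) 0 j) ((b *m G) 0 j).
  rewrite !mxE; apply/eqP; rewrite eq_complex /=.
  rewrite (raddf_sum (@Re R)) (raddf_sum (@Im R)) /=.
  apply/andP; split; apply/eqP/eq_bigr => i _; rewrite !mxE;
    by case: (v 0 i) => x y /=; ring.
case: z vN => x y vN.
have aB : a *m B = 0.
  apply/rowP => j; have := part _ B j; rewrite vB !mxE => /eqP.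
  by rewrite eq_complex /= => /andP[/eqP <-].
have bB : b *m B = 0.
  apply/rowP => j; have := part _ B j; rewrite vB !mxE => /eqP.
  by rewrite eq_complex /= => /andP[_ /eqP <-].
have aN : a *m N = x *: a - y *: b.
  apply/rowP => j; have := part _ N j; rewrite vN => /eqP.
  rewrite mxE vE eq_complex /= => /andP[/eqP E _].
  by rewrite -E !mxE.
have bN : b *m N = x *: b + y *: a.
  apply/rowP => j; have := part _ N j; rewrite vN => /eqP.
  rewrite mxE vE eq_complex /= => /andP[_ /eqP E].
  by rewrite -E !mxE addrC.
have sq (u : 'rV[R]_n) : (u *m u^T) 0 0 = \sum_i u 0 i ^+ 2.
  by rewrite mxE; apply: eq_bigr => i _; rewrite mxE expr2.
have sq_eq0 (u : 'rV[R]_n) : (u *m u^T) 0 0 = 0 -> u = 0.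
  rewrite sq => /eqP; rewrite psumr_eq0; last by move=> i _; exact: sqr_ge0.
  move=> /allP u0; apply/rowP => i; rewrite mxE.
  by have := u0 i (mem_index_enum _); rewrite sqrf_eq0 => /eqP.
have y0 : y = 0.
  apply/eqP/negPn/negP => yn0.
  have E : (a *m N *m b^T) 0 0 = (b *m N *m a^T) 0 0.
    by rewrite -[RHS](mxE trmx_key (fun i j => (b *m N *m a^T) j i))
      -/(trmx _) !trmx_mul trmxK Nsym mulmxA.
  have ab : (a *m b^T) 0 0 = (b *m a^T) 0 0.
    by rewrite -[RHS](mxE trmx_key (fun i j => (b *m a^T) j i))
      -/(trmx _) trmx_mul trmxK.
  move: E; rewrite aN bN mulmxBl mulmxDl -!scalemxAl.
  rewrite !mxE -!/(_ *m _) => E.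
  have F : y * ((a *m a^T) 0 0 + (b *m b^T) 0 0) = 0.
    by move: E ab; rewrite !mxE; nra.
  move/eqP: F; rewrite mulf_eq0 (negPf yn0) /= paddr_eq0 ?sq;
    try (by apply: sumr_ge0 => i _; exact: sqr_ge0).
  rewrite -!sq => /andP[/eqP/sq_eq0 a0 /eqP/sq_eq0 b0].
  move/eqP: v0; apply; apply/rowP => j; rewrite vE a0 b0 !mxE.
  by apply/eqP; rewrite eq_complex /= !eqxx.
rewrite y0 !scale0r subr0 in aN; rewrite y0 scale0r addr0 in bN.
have [a0|a0] := eqVneq a 0; last by exists a, x.
exists b, x => //; split=> //; apply/eqP => b0; move/eqP: v0; apply.
by apply/rowP => j; rewrite vE a0 b0 !mxE; apply/eqP; rewrite eq_complex /= !eqxx.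
Qed.

Lemma row_mul_trmx n (U V : 'M[R]_n) i j :
  (U *m V^T) i j = (row i U *m (row j V)^T) 0 0.
Proof. by rewrite !mxE; apply: eq_bigr => k _; rewrite !mxE. Qed.

Lemma row_sqr n (u : 'rV[R]_n) : (u *m u^T) 0 0 = \sum_i u 0 i ^+ 2.
Proof. by rewrite mxE; apply: eq_bigr => i _; rewrite mxE expr2. Qed.

Lemma row_sqr_eq0 n (u : 'rV[R]_n) : ((u *m u^T) 0 0 == 0) = (u == 0).
Proof.
apply/idP/eqP => [|->]; last by rewrite mul0mx mxE.
rewrite row_sqr psumr_eq0; last by move=> i _; exact: sqr_ge0.
move=> /allP u0; apply/rowP => i; rewrite mxE.
by have := u0 i (mem_index_enum _); rewrite sqrf_eq0 => /eqP.
Qed.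

(** The rows of U selected by e are orthonormal eigenvectors, the others vanish; a zero
    row is replaced by a unit eigenvector orthogonal to all rows until none is left.
    U = 0 gives the spectral theorem, N = 0 the completion of an orthonormal
    family. *)
Lemma extend_eigenbasis n (N U : 'M[R]_n) (e : pred 'I_n) (nu : 'rV[R]_n) :
  N^T = N -> U *m U^T = diag_mx (\row_i (e i)%:R) ->
  U *m N = diag_mx nu *m U ->
  exists (V : 'M[R]_n) nu', [/\ V *m V^T = 1%:M, V *m N = diag_mx nu' *m V
    & forall i, e i -> row i V = row i U].
Proof.
move=> Nsym; move: {2}#|_| (leqnn #|[pred i | ~~ e i]|) => k.
elim: k U e nu => [|k IH] U e nu ek UU UN.
  exists U, nu; split => //; rewrite UU; apply/matrixP => i j.
  rewrite !mxE; suff -> : e i by [].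
  apply/negPn/negP => nei; move: ek; rewrite leqn0 => /eqP/card0_eq/(_ i).
  by rewrite inE nei.
have [i0 ei0|e1] := pickP [pred i | ~~ e i]; last first.
  apply: (IH U e nu) => //; rewrite eq_card0 // => i; exact: e1.
rewrite /= in ei0.
have Ui0 : row i0 U = 0.
  by apply/eqP; rewrite -row_sqr_eq0 -row_mul_trmx UU !mxE eqxx (negPf ei0).
have /det0P[w w0 wU] : \det U^T == 0.
  rewrite det_tr; apply/det0P; exists (delta_mx 0 i0); last by rewrite -rowE.
  apply/eqP => /matrixP/(_ 0 i0); rewrite !mxE !eqxx /=; apply/eqP.
  exact: oner_neq0.
have NU : N *m U^T = U^T *m diag_mx nu.
  by have := congr1 trmx UN; rewrite !trmx_mul Nsym tr_diag_mx.
have [v [z [v0 vU] vN]] := sym_eigenvector_in_complement Nsym NU w0 wU.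
pose s := Num.sqrt ((v *m v^T) 0 0).
have sv : 0 < (v *m v^T) 0 0.
  rewrite lt_neqAle eq_sym row_sqr_eq0 v0 row_sqr.
  by apply: sumr_ge0 => i _; exact: sqr_ge0.
have s2 : s ^+ 2 = (v *m v^T) 0 0 by rewrite sqr_sqrtr ?ltW.
have s0 : s != 0 by rewrite sqrtr_eq0 -ltNge.
pose u := s^-1 *: v.
have uu : (u *m u^T) 0 0 = 1.
  rewrite /u linearZ /= -scalemxAr -scalemxAl scalerA mxE -s2.
  by field.
have uN : u *m N = z *: u.
  by rewrite /u -scalemxAl vN !scalerA mulrC.
have uU i : u *m (row i U)^T = 0.
  by rewrite /u -scalemxAl tr_row colE mulmxA vU mul0mx scaler0.
have Uu i : row i U *m u^T = 0.
  by rewrite -[row i U]trmxK -trmx_mul uU trmx0.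
pose U1 := \matrix_i (if i == i0 then u else row i U).
pose e1 : pred 'I_n := fun i => (i == i0) || e i.
pose nu1 := \row_i (if i == i0 then z else nu 0 i).
have U1i i : row i U1 = if i == i0 then u else row i U by rewrite rowK.
have [|||V [nu' [VV VN VU]]] := IH U1 e1 nu1.
- rewrite -ltnS; apply: leq_trans ek; apply: proper_card; apply/properP; split.
    by apply/fintype.subsetP => i; rewrite !inE /e1 negb_or => /andP[].
  by exists i0; rewrite !inE /e1 ?eqxx.
- apply/matrixP => i j; rewrite row_mul_trmx !U1i.
  have UUij : (row i U *m (row j U)^T) 0 0 = (e i)%:R *+ (i == j).
    by rewrite -row_mul_trmx UU !mxE.
  have zero00 : (0 : 'M[R]_1) 0 0 = 0 by rewrite mxE.
  rewrite [RHS]mxE [X in GRing.natmul X _]mxE /e1.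
  have [ii0|ii0] := boolP (i == i0); have [ji0|ji0] := boolP (j == i0);
    rewrite ?uu ?uU ?Uu ?UUij ?zero00 //.
  + by rewrite (eqP ii0) (eqP ji0) eqxx.
  + by rewrite (eqP ii0) eq_sym (negPf ji0).
  + by rewrite (eqP ji0) (negPf ii0).
- apply/row_matrixP => i; rewrite !row_mul U1i row_diag_mx -scalemxAl -rowE U1i mxE.
  case: eqP => // _; have := congr1 (row i) UN.
  by rewrite !row_mul row_diag_mx -scalemxAl -rowE.
- exists V, nu'; split => // i ei; rewrite VU /e1 ?ei ?orbT // U1i.
  by case: eqP ei ei0 => // -> ->.
Qed.

Lemma symmetric_diagonalizable n (N : 'M[R]_n) : N^T = N ->
  exists (V : 'M[R]_n) nu, V *m V^T = 1%:M /\ V *m N = diag_mx nu *m V.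
Proof.
move=> Nsym; have [||V [nu [VV VN _]]] := @extend_eigenbasis n N 0 pred0 0 Nsym.
- by rewrite mul0mx; apply/matrixP => i j; rewrite !mxE mul0rn.
- by rewrite mul0mx mulmx0.
- by exists V, nu.
Qed.

(** * Frobenius norm and the nearest orthogonal matrix *)

Definition frob2 m n (M : 'M[R]_(m, n)) : R := \sum_i \sum_j M i j ^+ 2.

Lemma frob2_tr m n (M : 'M[R]_(m, n)) : frob2 M = \tr (M *m M^T).
Proof.
apply: eq_bigr => i _; rewrite mxE; apply: eq_bigr => j _.
by rewrite mxE expr2.
Qed.

Lemma frob2_orthl m n (V : 'M[R]_m) (M : 'M[R]_(m, n)) :
  V *m V^T = 1%:M -> frob2 (V *m M) = frob2 M.
Proof.
move=> /mulmx1C VV; rewrite !frob2_tr trmx_mul !mulmxA mxtrace_mulC !mulmxA.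
by rewrite VV mul1mx.
Qed.

Lemma frob2_orthr m n (V : 'M[R]_n) (M : 'M[R]_(m, n)) :
  V *m V^T = 1%:M -> frob2 (M *m V) = frob2 M.
Proof.
by move=> VV; rewrite !frob2_tr trmx_mul !mulmxA -(mulmxA M) VV mulmx1.
Qed.

Lemma frob2_diag n (d : 'rV[R]_n) : frob2 (diag_mx d) = \sum_i d 0 i ^+ 2.
Proof.
apply: eq_bigr => i _; rewrite (bigD1 i) //= mxE eqxx big1 ?addr0 // => j ji.
by rewrite mxE eq_sym (negPf ji) mulr0n expr0n.
Qed.

(** By polar decomposition K = W^T diag(s) V with V and W orthogonal, and W^T V does:
    the two sides become the sums of (1 - s_i)^2 and of (1 - s_i^2)^2.  Singular K
    needs the completion of the rows of W. *)
Lemma nearest_orthogonal n (K : 'M[R]_n) :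
  exists2 O : 'M[R]_n, O *m O^T = 1%:M & frob2 (O - K) <= frob2 (1%:M - K^T *m K).
Proof.
have [|V [nu [VV VN]]] := @symmetric_diagonalizable n (K^T *m K).
  by rewrite trmx_mul trmxK.
have VtV : V^T *m V = 1%:M by exact: mulmx1C.
pose L := V *m K^T.
have LL : L *m L^T = diag_mx nu.
  by rewrite /L trmx_mul trmxK !mulmxA -(mulmxA V) VN -mulmxA VV mulmx1.
have KL : K = L^T *m V by rewrite /L trmx_mul trmxK -mulmxA VtV mulmx1.
clearbody L.
have Li i : (row i L *m (row i L)^T) 0 0 = nu 0 i.
  by rewrite -row_mul_trmx LL mxE eqxx.
have nu0 i : 0 <= nu 0 i.
  by rewrite -Li row_sqr; apply: sumr_ge0 => j _; exact: sqr_ge0.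
(* The rows of L = V K^T are orthogonal with squared norms nu_i; s holds the singular
   values of K and U the rows of L normalized, with 0 (the inverse of 0) for the
   rows that vanish. *)
pose s := \row_i Num.sqrt (nu 0 i).
have s2 i : s 0 i ^+ 2 = nu 0 i by rewrite mxE sqr_sqrtr.
pose e : pred 'I_n := fun i => s 0 i != 0.
pose U := diag_mx (map_mx GRing.inv s) *m L.
have [|||W [_ [WW _ WU]]] := @extend_eigenbasis n 0 U e 0.
- exact: trmx0.
- rewrite /U trmx_mul tr_diag_mx !mulmxA -(mulmxA _ L) LL.
  rewrite !mulmx_diag; congr diag_mx; apply/rowP => i; rewrite !mxE.
  rewrite -{2}[nu 0 i]sqr_sqrtr // /e mxE.
  have [->|si0] := eqVneq (Num.sqrt (nu 0 i)) 0; first by rewrite expr0n mulr0 mul0r.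
  by rewrite -[RHS]/1; field.
- by rewrite mulmx0 (_ : diag_mx 0 = 0) ?mul0mx //; apply/matrixP => i j;
    rewrite !mxE mul0rn.
have WtW : W^T *m W = 1%:M by exact: mulmx1C.
have LE : L = diag_mx s *m W.
  apply/row_matrixP => i; rewrite row_mul row_diag_mx -scalemxAl -rowE.
  have [si0|si0] := eqVneq (s 0 i) 0.
    by rewrite si0 scale0r; apply/eqP; rewrite -row_sqr_eq0 Li -s2 si0 expr0n.
  rewrite WU // /U row_mul row_diag_mx -scalemxAl -rowE.
  rewrite [(map_mx _ _) 0 i]mxE scalerA.
  by rewrite mulfV // scale1r.
have KE : K = W^T *m diag_mx s *m V.
  by rewrite KL LE trmx_mul tr_diag_mx.
exists (W^T *m V).
  by rewrite trmx_mul trmxK !mulmxA -(mulmxA _ V) VV mulmx1 WtW.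
have diag1 : 1%:M = diag_mx (const_mx 1) :> 'M[R]_n by rewrite diag_const_mx.
have -> : W^T *m V - K = W^T *m (diag_mx (const_mx 1 - s)) *m V.
  by rewrite linearB /= -diag1 mulmxBr mulmxBl mulmx1 -KE.
have -> : 1%:M - K^T *m K = V^T *m (diag_mx (const_mx 1 - nu)) *m V.
  rewrite linearB /= -diag1 mulmxBr mulmxBl mulmx1 VtV.
  by rewrite -(mulmxA V^T) -VN (mulmxA V^T V) VtV mul1mx.
rewrite !(frob2_orthr _ VV) !frob2_orthl ?trmxK // !frob2_diag.
apply: ler_sum => i _.
have -> : (const_mx 1 - s) 0 i = 1 - s 0 i by rewrite mxE mxE [(- s) 0 i]mxE.
have -> : (const_mx 1 - nu) 0 i = 1 - s 0 i ^+ 2.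
  by rewrite mxE mxE [(- nu) 0 i]mxE s2.
have : 0 <= s 0 i by rewrite mxE sqrtr_ge0.
move: (s 0 i) => t t0.
have -> : 1 - t ^+ 2 = (1 - t) * (1 + t) by ring.
rewrite exprMn ler_peMr ?sqr_ge0 //.
by rewrite exprn_ege1 // lerDl.
Qed.

(** * The Hoffman-Wielandt inequality *)

(** Summation by parts. *)
Lemma partial_sums_le0_sum_le (m : nat) (a e : nat -> R) :
  (forall i, (i < m)%N -> a i.+1 <= a i) ->
  (forall p, (p <= m)%N -> \sum_(i < p) e i <= 0) ->
  \sum_(i < m.+1) a i * e i <= a m * \sum_(i < m.+1) e i.
Proof.
elim: m => [|m IH] adec e0; first by rewrite !big_ord_recr !big_ord0 /= !add0r.
rewrite big_ord_recr [in leRHS]big_ord_recr /= mulrDr lerD2r.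
apply: (le_trans (IH _ _)) => [i im|p pm|].
- by apply: adec; exact: ltnW.
- by apply: e0; exact: leqW.
- by rewrite ler_wnM2r ?e0 ?adec.
Qed.

(** Averaging b by the rows of s can only decrease its partial sums and preserves the
    total; summation by parts against the nonincreasing a then gives the claim. *)
Lemma doubly_stochastic_rearrangement n (s : 'I_n -> 'I_n -> R)
    (a b : 'I_n -> R) :
  (forall i k, 0 <= s i k) ->
  (forall i, \sum_k s i k = 1) -> (forall k, \sum_i s i k = 1) ->
  (forall i j : 'I_n, (i <= j)%N -> a j <= a i) ->
  (forall i j : 'I_n, (i <= j)%N -> b j <= b i) ->
  \sum_i \sum_k s i k * (a i * b k) <= \sum_i a i * b i.
Proof.
case: n s a b => [|n] s a b s0 srow scol adec bdec; first by rewrite !big_ord0.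
pose e i := \sum_k s (inord i) k * b k - b (inord i).
rewrite -subr_le0 -sumrB.
rewrite (_ : \sum_i _ = \sum_(i < n.+1) a (inord i) * e i); last first.
  apply: eq_bigr => i _; rewrite /e !inord_val mulrBr mulr_sumr; congr (_ - _).
  by apply: eq_bigr => k _; rewrite mulrCA.
have part p : (p <= n.+1)%N -> \sum_(i < p) e i <= 0.
  move=> pn; case: p pn => [|p] pn; first by rewrite big_ord0.
  pose T (i : 'I_n.+1) := (i < p.+1)%N.
  have eT : \sum_(i < p.+1) e i = \sum_(i < n.+1 | T i) e i.
    by rewrite (big_ord_widen n.+1 e pn).
  pose sig k := \sum_(i < n.+1 | T i) s i k.
  have sumsig : \sum_k sig k = \sum_(k < n.+1) (T k)%:R.
    rewrite exchange_big /= [LHS](eq_bigr (fun=> 1)) => [|i _]; last exact: srow.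
    by rewrite [LHS]big_mkcond; apply: eq_bigr => k _; case: (T k).
  have sigb k : 0 <= sig k <= 1.
    rewrite sumr_ge0 => [|i _]; last exact: s0.
    rewrite /= -(scol k) /sig big_mkcond; apply: ler_sum => i _.
    by case: (T i).
  rewrite eT /e sumrB exchange_big /=.
  rewrite (_ : \sum_k _ = \sum_k sig k * b k); last first.
    apply: eq_bigr => k _; rewrite mulr_suml; apply: eq_bigr => i _.
    by rewrite inord_val.
  rewrite (_ : \sum_(i | T i) _ = \sum_k (T k)%:R * b k); last first.
    rewrite big_mkcond; apply: eq_bigr => k _; rewrite inord_val.
    by case: (T k); rewrite ?mul1r ?mul0r.
  (* Both weight families have the same total, so b may be shifted by its value at p:
     every term then has the right sign. *)
  pose q := b (inord p).
  have -> : \sum_k sig k * b k - \sum_k (T k)%:R * b k =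
      \sum_k (sig k - (T k)%:R) * (b k - q).
    under [RHS]eq_bigr do rewrite mulrBr.
    rewrite sumrB -mulr_suml [X in _ - X * _]sumrB sumsig subrr mul0r subr0.
    by rewrite -sumrB; apply: eq_bigr => k _; rewrite mulrBl.
  apply: sumr_le0 => k _; have /andP[sig0 sig1] := sigb k; rewrite /T.
  have pE : (inord p : 'I_n.+1) = p :> nat by rewrite inordK.
  have [kp|pk] := ltnP k p.+1.
    by rewrite mulr_le0_ge0 ?subr_le0 // subr_ge0 bdec // pE.
  by rewrite subr0 mulr_ge0_le0 // subr_le0 bdec // pE ltnW.
apply: (le_trans (partial_sums_le0_sum_le (a := fun i : nat => a (inord i))
  (e := e) _ _)) => [i ni|p pn|].
- by rewrite adec // !inordK // ltnS ltnW.
- by apply: part; exact: leqW.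
rewrite (_ : \sum_(i < n.+1) e i = 0) ?mulr0 // /e sumrB exchange_big /=.
apply/eqP; rewrite subr_eq0; apply/eqP; apply: eq_bigr => k _.
rewrite inord_val -mulr_suml (_ : \sum_i _ = 1) ?mul1r // -(scol k).
by apply: eq_bigr => i _; rewrite inord_val.
Qed.

(** In the eigenbasis V of N the right-hand side is the sum of
    W_ik^2 (b_k - nu_i)^2 with W = V O orthogonal, and the matrix of the W_ik^2 is doubly
    stochastic. *)
Lemma hoffman_wielandt n (N V O : 'M[R]_n) (nu b : 'rV[R]_n) :
  V *m V^T = 1%:M -> V *m N = diag_mx nu *m V -> O *m O^T = 1%:M ->
  (forall i j : 'I_n, (i <= j)%N -> nu 0 j <= nu 0 i) ->
  (forall i j : 'I_n, (i <= j)%N -> b 0 j <= b 0 i) ->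
  \sum_i (b - nu) 0 i ^+ 2 <= frob2 (O *m diag_mx b - N *m O).
Proof.
move=> VV VN OO nudec bdec; pose W := V *m O.
have WW : W *m W^T = 1%:M.
  by rewrite trmx_mul mulmxA -(mulmxA V) OO mulmx1.
have -> : frob2 (O *m diag_mx b - N *m O) =
    frob2 (W *m diag_mx b - diag_mx nu *m W).
  by rewrite -(frob2_orthl _ VV) mulmxBr !mulmxA VN.
clearbody W.
have row1 i : \sum_k W i k ^+ 2 = 1.
  have /matrixP/(_ i i) := WW; rewrite !mxE eqxx => E; rewrite -[RHS]E.
  by apply: eq_bigr => k _; rewrite mxE expr2.
have col1 k : \sum_i W i k ^+ 2 = 1.
  have /matrixP/(_ k k) := mulmx1C WW; rewrite !mxE eqxx => E; rewrite -[RHS]E.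
  by apply: eq_bigr => i _; rewrite mxE expr2.
have := doubly_stochastic_rearrangement (fun i k => sqr_ge0 (W i k))
  row1 col1 nudec bdec.
have -> : frob2 (W *m diag_mx b - diag_mx nu *m W) =
    \sum_i \sum_k (W i k ^+ 2 * nu 0 i ^+ 2 + W i k ^+ 2 * b 0 k ^+ 2
      - 2 * (W i k ^+ 2 * (nu 0 i * b 0 k))).
  apply: eq_bigr => i _; apply: eq_bigr => k _.
  by rewrite mul_mx_diag mul_diag_mx !mxE; ring.
have -> : \sum_i \sum_k (W i k ^+ 2 * nu 0 i ^+ 2 + W i k ^+ 2 * b 0 k ^+ 2
      - 2 * (W i k ^+ 2 * (nu 0 i * b 0 k))) =
    \sum_i nu 0 i ^+ 2 + \sum_i b 0 i ^+ 2
      - 2 * \sum_i \sum_k W i k ^+ 2 * (nu 0 i * b 0 k).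
  have -> : \sum_i nu 0 i ^+ 2 = \sum_i \sum_k W i k ^+ 2 * nu 0 i ^+ 2.
    by apply: eq_bigr => i _; rewrite -mulr_suml row1 mul1r.
  have -> : \sum_i b 0 i ^+ 2 = \sum_i \sum_k W i k ^+ 2 * b 0 k ^+ 2.
    rewrite exchange_big; apply: eq_bigr => k _.
    by rewrite -mulr_suml col1 mul1r.
  rewrite mulr_sumr -big_split -sumrB; apply: eq_bigr => i _ /=.
  by rewrite mulr_sumr -big_split -sumrB.
have -> : \sum_i (b - nu) 0 i ^+ 2 = \sum_i nu 0 i ^+ 2 + \sum_i b 0 i ^+ 2
    - 2 * \sum_i nu 0 i * b 0 i.
  rewrite mulr_sumr -big_split -sumrB /=; apply: eq_bigr => i _.
  by rewrite !mxE; ring.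
lra.
Qed.

(** * Eigenvalues seen through a nearly orthogonal frame *)

Definition frob m n (M : 'M[R]_(m, n)) : R := Num.sqrt (frob2 M).

Lemma frob2_ge0 m n (M : 'M[R]_(m, n)) : 0 <= frob2 M.
Proof. by apply: sumr_ge0 => i _; apply: sumr_ge0 => j _; exact: sqr_ge0. Qed.

Lemma frob_ge0 m n (M : 'M[R]_(m, n)) : 0 <= frob M.
Proof. exact: sqrtr_ge0. Qed.

Lemma frob_sqr m n (M : 'M[R]_(m, n)) : frob M ^+ 2 = frob2 M.
Proof. by rewrite sqr_sqrtr ?frob2_ge0. Qed.

Lemma frob_le m n (M : 'M[R]_(m, n)) (x : R) :
  0 <= x -> (frob M <= x) = (frob2 M <= x ^+ 2).
Proof. by move=> x0; rewrite -frob_sqr ler_pXn2r ?nnegrE ?frob_ge0. Qed.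

Lemma frobN m n (M : 'M[R]_(m, n)) : frob (- M) = frob M.
Proof.
by congr Num.sqrt; apply: eq_bigr => i _; apply: eq_bigr => j _; rewrite mxE sqrrN.
Qed.

Lemma frobD m n (A B : 'M[R]_(m, n)) : frob (A + B) <= frob A + frob B.
Proof.
rewrite frob_le ?addr_ge0 ?frob_ge0 // sqrrD !frob_sqr.
have /(_ R (fun p => A p.1 p.2) (fun p => B p.1 p.2)) CS :=
  @sum_CauchySchwarz _ ('I_m * 'I_n)%type.
have pairE (F : 'I_m -> 'I_n -> R) :
  \sum_(p : 'I_m * 'I_n) F p.1 p.2 = \sum_i \sum_j F i j by rewrite pair_big.
rewrite (pairE (fun i j => A i j ^+ 2)) (pairE (fun i j => B i j ^+ 2)) in CS.
rewrite (pairE (fun i j => A i j * B i j)) in CS.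
have -> : frob2 (A + B) = frob2 A + frob2 B + 2 * \sum_i \sum_j A i j * B i j.
  rewrite mulr_sumr -!big_split; apply: eq_bigr => i _ /=.
  by rewrite mulr_sumr -!big_split; apply: eq_bigr => j _ /=; rewrite mxE; ring.
have : \sum_i \sum_j A i j * B i j <= frob A * frob B.
  rewrite -/(frob2 A) -/(frob2 B) -!frob_sqr -exprMn in CS.
  apply: le_trans (ler_norm _) _.
  by rewrite -(@ler_pXn2r _ 2) ?nnegrE ?mulr_ge0 ?frob_ge0 // real_normK ?num_real.
lra.
Qed.

Lemma frob_diagl m n (d : 'rV[R]_m) (M : 'M[R]_(m, n)) q :
  0 <= q -> (forall i, `|d 0 i| <= q) -> frob (diag_mx d *m M) <= q * frob M.
Proof.
move=> q0 dq; rewrite frob_le ?mulr_ge0 ?frob_ge0 // exprMn frob_sqr.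
rewrite mulr_sumr; apply: ler_sum => i _; rewrite mulr_sumr.
apply: ler_sum => j _; rewrite mul_diag_mx mxE exprMn ler_wpM2r ?sqr_ge0 //.
by rewrite -real_normK ?num_real // ler_pXn2r ?nnegrE.
Qed.

Lemma frob_tr m n (M : 'M[R]_(m, n)) : frob M^T = frob M.
Proof.
congr Num.sqrt; rewrite /frob2 exchange_big; apply: eq_bigr => i _.
by apply: eq_bigr => j _; rewrite mxE.
Qed.

Lemma frob2_col m n (M : 'M[R]_(m, n)) : frob2 M = \sum_j frob2 (col j M).
Proof.
rewrite /frob2 exchange_big; apply: eq_bigr => j _; apply: eq_bigr => i _.
by rewrite big_ord_recl big_ord0 addr0 mxE.
Qed.

Lemma frob_mull m n (N : 'M[R]_m) (M : 'M[R]_(m, n)) r : 0 <= r ->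
  (forall v : 'cV_m, frob2 (N *m v) <= r ^+ 2 * frob2 v) ->
  frob (N *m M) <= r * frob M.
Proof.
move=> r0 Nr; rewrite frob_le ?mulr_ge0 ?frob_ge0 // exprMn frob_sqr.
rewrite (frob2_col (N *m M)) (frob2_col M) mulr_sumr; apply: ler_sum => j _.
by rewrite colE -mulmxA -colE Nr.
Qed.

(** K stands for the change of frame.  Hoffman-Wielandt is applied with the orthogonal
    matrix O nearest to K, and the error is split into the residual of K, the cost
    of replacing K by O on either side, and (lam - c) O. *)
Lemma eigenvalues_near_compression n (K N V : 'M[R]_n) (lam b nu : 'rV[R]_n)
    (c m r f h : R) :
  V *m V^T = 1%:M -> V *m N = diag_mx nu *m V ->
  (forall i j : 'I_n, (i <= j)%N -> nu 0 j <= nu 0 i) ->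
  (forall i j : 'I_n, (i <= j)%N -> b 0 j <= b 0 i) ->
  0 <= m -> 0 <= r ->
  (forall i, `|lam 0 i - c| <= m) -> (forall i, `|b 0 i - c| <= m + r) ->
  (forall v : 'cV_n, frob2 (N *m v) <= r ^+ 2 * frob2 v) ->
  frob (K *m diag_mx b - (diag_mx lam + N) *m K) <= f ->
  frob (1%:M - K^T *m K) <= h ->
  Num.sqrt (\sum_i (b 0 i - c - nu 0 i) ^+ 2) <=
    f + 2 * (m + r) * h + Num.sqrt (\sum_i (lam 0 i - c) ^+ 2).
Proof.
move=> VV VN nudec bdec m0 r0 lamc bc Nr Kf Kh.
have [ O OO OK] := nearest_orthogonal K.
have OKh : frob (O - K) <= h by apply: le_trans Kh; rewrite ler_wsqrtr.
have mr0 : 0 <= m + r by rewrite addr_ge0.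
pose b' := b - const_mx c; pose lam' := lam - const_mx c.
have b'E i : b' 0 i = b 0 i - c by rewrite !mxE.
have lam'E i : lam' 0 i = lam 0 i - c by rewrite !mxE.
have dE d : diag_mx (d - const_mx c) = diag_mx d - c%:M :> 'M[R]_n.
  by rewrite linearB /= diag_const_mx.
have HW : Num.sqrt (\sum_i (b 0 i - c - nu 0 i) ^+ 2) <=
    frob (O *m diag_mx b' - N *m O).
  rewrite ler_wsqrtr //; apply: le_trans (hoffman_wielandt VV VN OO nudec _).
    by apply: ler_sum => i _; rewrite !mxE.
  by move=> i j ij; rewrite !b'E lerD2r bdec.
apply: (le_trans HW).
have -> : O *m diag_mx b' - N *m O =
    (K *m diag_mx b - (diag_mx lam + N) *m K) + ((O - K) *m diag_mx b'
    + (- (diag_mx lam' *m (O - K)) + - (N *m (O - K)))) + diag_mx lam' *m O.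
  rewrite /b' /lam' !dE !(mulmxBl, mulmxBr, mulmxDl, mulmxDr).
  rewrite !mul_mx_scalar !mul_scalar_mx.
  by apply/matrixP => i j; rewrite !mxE; ring.
have lamO : frob (diag_mx lam' *m O) = Num.sqrt (\sum_i (lam 0 i - c) ^+ 2).
  rewrite /frob frob2_orthr // frob2_diag.
  by congr Num.sqrt; apply: eq_bigr => i _; rewrite lam'E.
rewrite -lamO; apply: le_trans (frobD _ _) _; rewrite lerD2r.
apply: le_trans (frobD _ _) _; apply: lerD => //.
apply: le_trans (frobD _ _) _.
have Ob : frob ((O - K) *m diag_mx b') <= (m + r) * h.
  rewrite -frob_tr trmx_mul tr_diag_mx.
  apply: le_trans (frob_diagl _ mr0 _) _ => [i|]; first by rewrite b'E.
  by rewrite frob_tr ler_wpM2l.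
have Ol : frob (- (diag_mx lam' *m (O - K))) <= m * h.
  rewrite frobN; apply: le_trans (frob_diagl _ m0 _) _ => [i|]; first by rewrite lam'E.
  by rewrite ler_wpM2l.
have ON : frob (- (N *m (O - K))) <= r * h.
  rewrite frobN; apply: le_trans (frob_mull _ r0 Nr) _.
  by rewrite ler_wpM2l.
have := frobD (- (diag_mx lam' *m (O - K))) (- (N *m (O - K))).
lra.
Qed.

End RealSpectral.

(** * The ordered spectrum of a symmetric matrix *)

Lemma char_poly_orthogonal_diag (R : realType) n (N V : 'M[R]_n) (nu : 'rV[R]_n) :
  V *m V^T = 1%:M -> V *m N = diag_mx nu *m V ->
  char_poly N = \prod_i ('X - (nu 0 i)%:P).
Proof.
move=> VV VN; have VtV := mulmx1C VV.
have NE : N = V^T *m diag_mx nu *m V by rewrite -mulmxA -VN mulmxA VtV mul1mx.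
have -> : char_poly N = char_poly (diag_mx nu).
  have VVP : map_mx polyC V^T *m map_mx polyC V = 1%:M.
    by rewrite -map_mxM VtV map_mx1.
  have cE : char_poly_mx N =
      map_mx polyC V^T *m char_poly_mx (diag_mx nu) *m map_mx polyC V.
    rewrite /char_poly_mx NE !map_mxM mulmxBr mulmxBl.
    by rewrite mul_mx_scalar -scalemxAl VVP scalemx1.
  by rewrite /char_poly cE !det_mulmx mulrAC -det_mulmx VVP det1 mul1r.
rewrite char_poly_trig; last exact: diag_mx_is_trig.
by apply: eq_bigr => i _; rewrite mxE eqxx mulr1n.
Qed.

(** Existence: sort the eigenvalues of a diagonalization.  Whatever sorted tuple the
    characteristic polynomial selects is a permutation of them, and the rows of V are
    permuted accordingly. *)
Lemma spec_down_diagonalizes (R : realType) n (N : 'M[R]_n) : N^T = N ->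
  exists V : 'M[R]_n, [/\ V *m V^T = 1%:M, V *m N = diag_mx (spec_down N) *m V &
    forall i j : 'I_n, (i <= j)%N -> spec_down N 0 j <= spec_down N 0 i].
Proof.
move=> /symmetric_diagonalizable[V [nu [VV VN]]].
have cp := char_poly_orthogonal_diag VV VN.
pose t := [tuple nu 0 i | i < n].
have cpt : char_poly N = \prod_(a <- t) ('X - a%:P).
  by rewrite cp big_tuple; apply: eq_bigr => i _; rewrite tnth_mktuple.
rewrite /spec_down; set s := xget _ _.
have [s_sorted cps] : sorted >=%R s /\ char_poly N = \prod_(a <- s) ('X - a%:P).
  rewrite /s; apply: (@xgetPex _ (nseq_tuple n 0)
    [set s : n.-tuple R | sorted >=%R s /\ char_poly N = \prod_(a <- s) ('X - a%:P)]).
  have st : size (sort >=%R t) == n by rewrite size_sort size_tuple.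
  exists (Tuple st); split => /=.
    by apply: sort_sorted => x y; exact: le_total.
  by rewrite cpt; apply: perm_big; rewrite perm_sym perm_sort.
have : perm_eq s t by apply: prod_XsubC_eq; rewrite -cps -cpt.
move=> /tuple_permP[p sE].
have sp i : tnth s i = nu 0 (p i).
  have := congr1 (fun r => nth 0 r i) sE; rewrite -tnth_nth => ->.
  by rewrite -[LHS](tnth_nth 0 [tuple tnth t (p i) | i < n]) !tnth_mktuple.
have rowp i : row i (row_perm p V) = row (p i) V.
  by apply/rowP => j; rewrite !mxE.
exists (row_perm p V); split.
- apply/matrixP => i j; rewrite row_mul_trmx !rowp -row_mul_trmx VV !mxE.
  by rewrite (inj_eq perm_inj).
- apply/row_matrixP => i; rewrite !row_mul row_diag_mx -scalemxAl -rowE !rowp.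
  have := congr1 (row (p i)) VN.
  by rewrite !row_mul row_diag_mx -scalemxAl -rowE => ->; rewrite mxE sp.
- move=> i j ij; rewrite !mxE !(tnth_nth 0).
  by apply: (sorted_leq_nth _ _ 0 s_sorted); rewrite ?inE ?size_tuple //;
    [move=> x y z /[swap]; exact: le_trans|exact: lexx].
Qed.

(** * Parseval calculus in a complete system of eigenvectors *)

Section Hilbert.
Variables (R : realType) (H : completeNormedModType R) (ip : {dot H for idfun}).
Hypothesis Hip : norm_from ip.
Import summability.

#[local] Existing Instance totally_filter.

Lemma ipC x y : ip x y = ip y x.
Proof. by rewrite (hermC ip) /= expr0 mul1r. Qed.

Lemma ipDl x y z : ip (x + y) z = ip x z + ip y z.
Proof. exact: linearDl. Qed.

Lemma ipDr x y z : ip z (x + y) = ip z x + ip z y.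
Proof. exact: linearDr. Qed.

Lemma ipBl x y z : ip (x - y) z = ip x z - ip y z.
Proof. exact: linearBl. Qed.

Lemma ipBr x y z : ip z (x - y) = ip z x - ip z y.
Proof. exact: linearBr. Qed.

Lemma ipZl a x z : ip (a *: x) z = a * ip x z.
Proof. exact: linearZl_LR. Qed.

Lemma ipZr a x z : ip z (a *: x) = a * ip z x.
Proof. exact: linearZr_LR. Qed.

Lemma ip0r z : ip z 0 = 0.
Proof. exact: linear0r. Qed.

Lemma ip_suml I (r : seq I) (P : pred I) (F : I -> H) z :
  ip (\sum_(i <- r | P i) F i) z = \sum_(i <- r | P i) ip (F i) z.
Proof. exact: linear_sumlz. Qed.

Lemma ip_sumr I (r : seq I) (P : pred I) (F : I -> H) z :
  ip z (\sum_(i <- r | P i) F i) = \sum_(i <- r | P i) ip z (F i).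
Proof. exact: linear_sumr. Qed.

Lemma ip_CauchySchwarz x y : `|ip x y| <= `|x| * `|y|.
Proof.
have [->|y0] := eqVneq y 0; first by rewrite ip0r !normr0 mulr0.
have ny : 0 < `|y| by rewrite normr_gt0.
suff : ip x y ^+ 2 <= (`|x| * `|y|) ^+ 2.
  by rewrite -[in X in X -> _]real_normK ?num_real // ler_pXn2r ?nnegrE ?mulr_ge0.
have : 0 <= `|(`|y| ^+ 2) *: x - ip x y *: y| ^+ 2 by exact: sqr_ge0.
rewrite Hip ipBl !ipBr !ipZl !ipZr -!Hip (ipC y x) => E.
have {E} : 0 <= `|y| ^+ 2 * ((`|x| * `|y|) ^+ 2 - ip x y ^+ 2) by rewrite exprMn; lra.
by rewrite pmulr_rge0 ?exprn_gt0 // subr_ge0.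
Qed.

Lemma cvg_ip (T : Type) (F : set_system T) {FF : ProperFilter F} (f : T -> H) x y :
  f @ F --> x -> (fun t => ip (f t) y) @ F --> ip x y.
Proof.
move=> fx; apply/cvgrPdist_le => e e0.
have y1 : 0 < `|y| + 1 by rewrite ltr_pwDr.
have /cvgrPdist_le/(_ (e / (`|y| + 1)) (divr_gt0 e0 y1)) := fx.
apply: filterS => t; rewrite ler_pdivlMr // => h.
rewrite -ipBl; apply: le_trans (ip_CauchySchwarz _ _) _; apply: le_trans h.
by rewrite ler_wpM2l // lerDl.
Qed.

Section Expansion.
Variables (A : {linear H -> H}) (S : eigensystem H).
Hypothesis HS : eigensystem_of ip A S.

Definition coef i x : R := if i \in idx S then ip (eigvec S i) x else 0.

Lemma eigprojE i x : eigproj ip S i x = coef i x *: eigvec S i.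
Proof. by rewrite /eigproj /coef; case: ifP => // _; rewrite scale0r. Qed.

Lemma coefE i x : idx S i -> coef i x = ip (eigvec S i) x.
Proof. by rewrite /coef => ?; rewrite mem_set. Qed.

Lemma coefN i x : ~ idx S i -> coef i x = 0.
Proof. by rewrite /coef => ?; rewrite memNset. Qed.

Lemma coefD i x y : coef i (x + y) = coef i x + coef i y.
Proof. by rewrite /coef; case: ifP => _; rewrite ?addr0 ?ipDr. Qed.

Lemma coefB i x y : coef i (x - y) = coef i x - coef i y.
Proof. by rewrite /coef; case: ifP => _; rewrite ?subr0 ?ipBr. Qed.

Lemma coefZ i a x : coef i (a *: x) = a * coef i x.
Proof. by rewrite /coef; case: ifP => _; rewrite ?mulr0 ?ipZr. Qed.

Lemma coef_eigvec i j : idx S j -> coef i (eigvec S j) = (i == j)%:R.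
Proof.
have [_ _ on _ _] := HS => ij; have [ii|ii] := pselect (idx S i).
  by rewrite coefE // on.
by rewrite coefN //; case: eqP => // E; rewrite E in ii.
Qed.

Lemma partial_sumE (V : zmodType) (f : nat + nat -> V) (B : {fset (nat + nat)%type}) :
  partial_sum f B = \sum_(i <- B) f i.
Proof. by rewrite /partial_sum big_seq_fsetE. Qed.

Lemma cvg_expansion x :
  (fun B : {fset (nat + nat)%type} => \sum_(i <- B) coef i x *: eigvec S i)
    @ totally --> x.
Proof.
have [_ _ _ _ /(_ x)] := HS.
have -> : partial_sum (fun i => eigproj ip S i x) =
    (fun B : {fset (nat + nat)%type} => \sum_(i <- B) coef i x *: eigvec S i).
  apply/funext => B; rewrite partial_sumE; apply: eq_bigr => i _.
  by rewrite eigprojE.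
by [].
Qed.

Lemma parseval x y :
  (fun B : {fset (nat + nat)%type} => \sum_(i <- B) coef i x * coef i y)
    @ totally --> ip x y.
Proof.
have -> : (fun B : {fset (nat + nat)%type} => \sum_(i <- B) coef i x * coef i y) =
    (fun B : {fset (nat + nat)%type} => ip (\sum_(i <- B) coef i x *: eigvec S i) y).
  apply/funext => B; rewrite ip_suml; apply: eq_bigr => i _; rewrite ipZl /coef.
  by case: ifP; rewrite ?mul0r.
exact: (cvg_ip (y := y) (@cvg_expansion x)).
Qed.

(** Through this lemma, comparing inner products or norms of vectors amounts to
    comparing their coefficients, one index at a time. *)
Lemma sum_ip_ge0 n (u v : 'I_n -> H) :
  (forall i, idx S i -> 0 <= \sum_k coef i (u k) * coef i (v k)) ->
  0 <= \sum_k ip (u k) (v k).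
Proof.
move=> uv.
have cv : (fun B : {fset (nat + nat)%type} =>
    \sum_(k < n) \sum_(i <- B) coef i (u k) * coef i (v k))
    @ totally --> \sum_k ip (u k) (v k).
  by apply: cvg_big => // [|k _]; [exact: add_continuous|exact: parseval].
rewrite -(cvg_lim _ cv) //; apply: limr_ge; first by apply/cvg_ex; eexists; exact: cv.
apply: nearW => B; rewrite exchange_big; apply: sumr_ge0 => i _ /=.
have [ii|ii] := pselect (idx S i); first exact: uv.
by rewrite big1 // => k _; rewrite !coefN ?mul0r.
Qed.

Lemma ip_ge0 u v :
  (forall i, idx S i -> 0 <= coef i u * coef i v) -> 0 <= ip u v.
Proof.
move=> uv; have := @sum_ip_ge0 1 (fun=> u) (fun=> v).
by rewrite !big_ord1; apply => i /uv; rewrite big_ord1.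
Qed.

Lemma ip2_ge0 u1 v1 u2 v2 :
  (forall i, idx S i -> 0 <= coef i u1 * coef i v1 + coef i u2 * coef i v2) ->
  0 <= ip u1 v1 + ip u2 v2.
Proof.
move=> uv; have := @sum_ip_ge0 2 (tnth [tuple u1; u2]) (tnth [tuple v1; v2]).
rewrite !big_ord_recr big_ord0 /= !(tnth_nth 0) /= add0r; apply => i /uv.
by rewrite !big_ord_recr big_ord0 /= !(tnth_nth 0) /= add0r.
Qed.

Lemma ip_eq_coef u1 v1 u2 v2 :
  (forall i, idx S i -> coef i u1 * coef i v1 = coef i u2 * coef i v2) ->
  ip u1 v1 = ip u2 v2.
Proof.
move=> uv; have neg u v : ip (- u) v = - ip u v by rewrite -scaleN1r ipZl mulN1r.
have negc i u : coef i (- u) = - coef i u by rewrite -scaleN1r coefZ mulN1r.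
have h1 : 0 <= ip u1 v1 - ip u2 v2.
  by rewrite -neg; apply: ip2_ge0 => i /uv E; rewrite negc mulNr E subrr.
have h2 : 0 <= ip u2 v2 - ip u1 v1.
  by rewrite -neg; apply: ip2_ge0 => i /uv E; rewrite negc mulNr E subrr.
by lra.
Qed.

Lemma sum_norm_le n m (a : 'I_n -> H) (b : 'I_m -> H) :
  (forall i, idx S i -> \sum_k coef i (a k) ^+ 2 <= \sum_k coef i (b k) ^+ 2) ->
  \sum_k `|a k| ^+ 2 <= \sum_k `|b k| ^+ 2.
Proof.
move=> ab; rewrite -subr_ge0.
pose u (k : 'I_(m + n)) := match fintype.split k with inl i => b i | inr j => - a j end.
pose v (k : 'I_(m + n)) := match fintype.split k with inl i => b i | inr j => a j end.
have spl : forall j, fintype.split (lshift n j) = inl j :> 'I_m + 'I_n.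
  by move=> j; rewrite -[lshift n j]/(unsplit (inl j)) unsplitK.
have spr : forall j, fintype.split (rshift m j) = inr j :> 'I_m + 'I_n.
  by move=> j; rewrite -[rshift m j]/(unsplit (inr j)) unsplitK.
have := @sum_ip_ge0 _ u v; rewrite big_split_ord /=.
rewrite (eq_bigr (fun k => `|b k| ^+ 2)); last by move=> k _; rewrite /u /v spl Hip.
rewrite [X in _ + X](eq_bigr (fun k => - `|a k| ^+ 2)); last first.
  by move=> k _; rewrite /u /v spr Hip -scaleN1r ipZl mulN1r.
rewrite sumrN; apply => i ii; rewrite big_split_ord /=.
rewrite (eq_bigr (fun k => coef i (b k) ^+ 2)); last first.
  by move=> k _; rewrite /u /v spl expr2.
rewrite [X in _ + X](eq_bigr (fun k => - coef i (a k) ^+ 2)); last first.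
  by move=> k _; rewrite /u /v spr -scaleN1r coefZ mulN1r mulNr expr2.
by rewrite sumrN subr_ge0 ab.
Qed.

Lemma norm_le_coef C x y : 0 <= C ->
  (forall i, idx S i -> `|coef i x| <= C * `|coef i y|) -> `|x| <= C * `|y|.
Proof.
move=> C0 xy; have := @sum_norm_le 1 1 (fun=> x) (fun=> C *: y).
rewrite !big_ord1 normrZ (ger0_norm C0) ler_pXn2r ?nnegrE ?mulr_ge0 //; apply => i ii.
rewrite !big_ord1 coefZ -real_normK ?num_real // -[leRHS]real_normK ?num_real //.
by rewrite ler_pXn2r ?nnegrE // normrM (ger0_norm C0) xy.
Qed.

Lemma coef_inj x y : (forall i, idx S i -> coef i x = coef i y) -> x = y.
Proof.
move=> xy; apply/eqP; rewrite -subr_eq0 -normr_le0 -[leRHS](mul0r `|x|).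
apply: norm_le_coef => // i ii.
by rewrite coefB xy // subrr normr0 mul0r.
Qed.

Lemma coef_A i x : selfadjoint ip A -> idx S i ->
  coef i (A x) = eigval S i * coef i x.
Proof.
have [_ _ _ ev _] := HS => sA ii.
by rewrite !coefE // -sA ev // ipZl.
Qed.

End Expansion.
End Hilbert.

(** * Diagonal operators and boundedness *)

Section Multiplier.
Variables (R : realType) (H : completeNormedModType R) (ip : {dot H for idfun}).
Hypothesis Hip : norm_from ip.
Variables (A : {linear H -> H}) (S : eigensystem H).
Hypothesis HS : eigensystem_of ip A S.
Import summability.
#[local] Existing Instance totally_filter.
Local Notation coef := (coef ip S).
Local Notation phi := (eigvec S).

Definition multiplier (w : nat + nat -> R) (x : H) : H :=
  summability.sum (fun i => w i *: eigproj ip S i x).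

Let psum w x (B : {fset (nat + nat)%type}) : H :=
  \sum_(i <- B) (w i * coef i x) *: phi i.

Lemma coef_psum w x B j : idx S j ->
  coef j (psum w x B) = if j \in B then w j * coef j x else 0.
Proof.
move=> jj; rewrite coefE // /psum ip_sumr.
have E i : ip (phi j) ((w i * coef i x) *: phi i) =
    if i == j then w j * coef j x else 0.
  rewrite ipZr -(coefE _ _ jj).
  have [ii|ii] := pselect (idx S i).
    rewrite (coef_eigvec HS) // eq_sym; case: eqP => [->|_]; rewrite ?mulr1 ?mulr0 //.
  by rewrite (coefN ip x ii) mulr0 mul0r; case: eqP => // E; rewrite E in ii.
under eq_bigr do rewrite E.
rewrite -big_mkcond -big_filter; case: ifPn => jB.
  by rewrite filter_pred1_uniq ?fset_uniq // big_seq1.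
by rewrite (_ : [seq _ <- _ | _] = [::]) ?big_nil //; apply/eqP;
  rewrite -(negbK (_ == _)) -has_filter has_pred1.
Qed.

(** The partial sums are Cauchy because a bounded w distorts the distances between
    partial sums of the expansion of x by a factor at most C. *)
Lemma cvg_multiplier w (C : R) x : 0 <= C -> (forall i, idx S i -> `|w i| <= C) ->
  psum w x @ totally --> multiplier w x.
Proof.
move=> C0 wC.
have P1 : psum (fun=> 1) x @ totally --> x.
  rewrite (_ : psum _ _ = fun B => \sum_(i <- B) coef i x *: phi i).
    exact: (@cvg_expansion _ _ _ _ _ HS).
  by apply/funext => B; apply: eq_bigr => i _; rewrite mul1r.
have dist B B' : `|psum w x B - psum w x B'| <=
    C * `|psum (fun=> 1) x B - psum (fun=> 1) x B'|.
  apply: (norm_le_coef Hip HS) => // j jj; rewrite !coefB !coef_psum // !mul1r.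
  have -> : (if j \in B then w j * coef j x else 0) -
      (if j \in B' then w j * coef j x else 0) =
    w j * ((if j \in B then coef j x else 0) - (if j \in B' then coef j x else 0)).
    by case: ifP; case: ifP => _ _; rewrite ?mulrBr ?mulr0.
  by rewrite normrM ler_wpM2r // wC.
have -> : multiplier w x = lim (psum w x @ totally).
  rewrite /multiplier /summability.sum; congr (lim (_ @ totally)).
  apply/funext => B; rewrite partial_sumE; apply: eq_bigr => i _.
  by rewrite eigprojE scalerA.
suff : cvg (psum w x @ totally) by [].
apply: cauchy_cvg; apply: cauchy_exP => e e0.
pose d := e / (2 * (C + 1)).
have C1 : 0 < 2 * (C + 1) by rewrite mulr_gt0 // ltr_wpDl.
have d0 : 0 < d by rewrite divr_gt0.
have /cvgrPdist_lt/(_ d d0) [B0 _ B0d] := P1.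
exists (psum w x B0).
exists B0 => // B /= BB; rewrite -ball_normE /=.
apply: le_lt_trans (dist _ _) _.
have h0 := B0d B0 (fsubset_refl _); have h1 := B0d B BB.
rewrite /= in h0 h1.
have h : `|psum (fun=> 1) x B0 - psum (fun=> 1) x B| <= d + d.
  rewrite -[X in `|X - _|](subrK x) -addrA.
  apply: le_trans (ler_normD _ _) _.
  by rewrite lerD // ltW // distrC.
apply: le_lt_trans (ler_wpM2l C0 h) _.
have dE : d * (2 * (C + 1)) = e by rewrite divfK // gt_eqF.
by rewrite -dE; lra.
Qed.

Lemma coef_multiplier w (C : R) x i : 0 <= C -> (forall i, idx S i -> `|w i| <= C) ->
  idx S i -> coef i (multiplier w x) = w i * coef i x.
Proof.
move=> C0 wC ii.
have c1 := cvg_ip Hip (FF := totally_filter) (y := phi i) (@cvg_multiplier w C x C0 wC).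
have c2 : (fun B => ip (psum w x B) (phi i)) @ totally --> w i * coef i x.
  apply: cvg_near_cst; exists [fset i]%fset => //= B /fsubsetP/(_ i).
  rewrite inE eqxx => /(_ isT) iB.
  by rewrite (ipC ip) -coefE // coef_psum // iB.
by rewrite coefE // (ipC ip); exact: cvg_unique c1 c2.
Qed.

End Multiplier.

Section Bounded.
Variables (R : realType) (H : completeNormedModType R).

Lemma compact_operator_bounded (A : {linear H -> H}) : compact_operator A ->
  exists2 C : R, 0 <= C & forall x, `|A x| <= C * `|x|.
Proof.
rewrite /compact_operator precompactE => /compact_bounded [M [Mr MA]].
have M1 : forall y, `|y| <= 1 -> `|A y| <= `|M| + 1.
  move=> y y1; apply: (MA (`|M| + 1)).
    by apply: le_lt_trans (ler_norm _) _; rewrite ltrDl.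
  by apply: subset_closure; exists y.
exists (`|M| + 1) => [|x]; first by rewrite addr_ge0.
have [->|x0] := eqVneq x 0; first by rewrite linear0 !normr0 mulr0.
have nx : 0 < `|x| by rewrite normr_gt0.
have := M1 (`|x|^-1 *: x); rewrite linearZ /= !normrZ normfV normr_id.
rewrite mulVf ?gt_eqF // => /(_ (lexx _)).
by rewrite ler_pdivrMl // mulrC.
Qed.

Lemma opnorm_bound (F : H -> H) (C : R) : (forall a x, F (a *: x) = a *: F x) ->
  (forall x, `|F x| <= C * `|x|) -> forall x, `|F x| <= opnorm F * `|x|.
Proof.
move=> FZ FC x.
have ub y : `|y| <= 1 -> `|F y| <= opnorm F.
  move=> y1; apply: ub_le_sup; last by exists y.
  exists `|C| => _ [z z1 <-]; apply: le_trans (FC z) _.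
  apply: le_trans (ler_norm _) _; rewrite normrM ler_piMr //.
  by rewrite normr_id.
have [->|x0] := eqVneq x 0.
  have -> : F 0 = 0 by rewrite -[X in F X](scale0r 0) FZ scale0r.
  by rewrite !normr0 mulr0.
have nx : 0 < `|x| by rewrite normr_gt0.
have := ub (`|x|^-1 *: x); rewrite FZ !normrZ normfV normr_id.
rewrite mulVf ?gt_eqF // => /(_ (lexx _)).
by rewrite ler_pdivrMl // mulrC.
Qed.
End Bounded.

(** * Rayleigh quotients and min-max *)

Section Ordering.
Variables (R : realType) (H : completeNormedModType R) (ip : {dot H for idfun}).
Hypothesis Hip : norm_from ip.
Variables (A : {linear H -> H}) (S : eigensystem H).
Hypothesis HS : eigensystem_of ip A S.
Hypotheses (sA : selfadjoint ip A) (pA : nonneg_eigenvalues A).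
Local Notation lam := (eigval S).

Lemma norm_eigvec i : idx S i -> `|eigvec S i| = 1.
Proof.
have [_ _ on _ _] := HS => ii; apply/eqP.
by rewrite -(@eqrXn2 _ 2) // expr1n Hip on // eqxx.
Qed.

Lemma eigval_ge0 i : idx S i -> 0 <= lam i.
Proof.
have [_ _ _ ev _] := HS => ii; apply: pA (ev _ ii).
by rewrite -normr_eq0 norm_eigvec // oner_eq0.
Qed.

Lemma eigval_le_above k i : idx S (inl k) -> idx S i ->
  (forall l, i = inl l -> (k <= l)%N) -> lam i <= lam (inl k).
Proof.
have [mono ker _ _ _] := HS => ik.
case: i => [l|l] il kl; first exact: (mono _ _ (kl l erefl) il).2.
by rewrite ker // eigval_ge0.
Qed.

Lemma rayleigh_le k x : idx S (inl k) ->
  (forall l, (l < k)%N -> coef ip S (inl l) x = 0) ->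
  ip (A x) x <= lam (inl k) * `|x| ^+ 2.
Proof.
move=> ik xk; rewrite Hip -ipZl -subr_ge0 -ipBl.
apply: (ip_ge0 Hip HS) => i ii; rewrite coefB coefZ (coef_A HS) // -mulrBl -mulrA.
have [l_lt|l_ge] := pselect (exists2 l, i = inl l & (l < k)%N).
  by have [l -> lk] := l_lt; rewrite xk // !mulr0.
rewrite mulr_ge0 -?expr2 ?sqr_ge0 // subr_ge0 eigval_le_above // => l il.
by rewrite leqNgt; apply/negP => lk; apply: l_ge; exists l.
Qed.

Lemma rayleigh_ge k x : idx S (inl k) ->
  (forall i, idx S i -> coef ip S i x != 0 -> exists2 l, (l <= k)%N & i = inl l) ->
  lam (inl k) * `|x| ^+ 2 <= ip (A x) x.
Proof.
have [mono _ _ _ _] := HS.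
move=> ik xk; rewrite Hip -ipZl -subr_ge0 -ipBl.
apply: (ip_ge0 Hip HS) => i ii; rewrite coefB coefZ (coef_A HS) // -mulrBl -mulrA.
have [->|x0] := eqVneq (coef ip S i x) 0; first by rewrite !mulr0.
have [l lk ->] := xk i ii x0.
rewrite mulr_ge0 -?expr2 ?sqr_ge0 // subr_ge0.
exact: (mono _ _ lk ik).2.
Qed.

End Ordering.

(** k + 1 eigenvectors of S' against k linear conditions: a nonzero combination of the
    first k + 1 eigenvectors of S' is orthogonal to the first k eigenvectors of S. *)
Lemma minmax_test_vector (R : realType) (H : completeNormedModType R)
    (ip : {dot H for idfun}) (Hip : norm_from ip) (A' : {linear H -> H})
    (S S' : eigensystem H) (k : nat) :
  eigensystem_of ip A' S' -> idx S' (inl k) ->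
  exists x : H, [/\ x != 0, forall l, (l < k)%N -> coef ip S (inl l) x = 0 &
    forall i, idx S' i -> coef ip S' i x != 0 -> exists2 l, (l <= k)%N & i = inl l].
Proof.
move=> HS' ik; have [mono _ _ _ _] := HS'.
have il (l : 'I_k.+1) : idx S' (inl (l : nat)).
  by apply: (mono l k _ ik).1; rewrite -ltnS.
pose M := \matrix_(i < k.+1, l < k) coef ip S (inl (l : nat)) (eigvec S' (inl (i : nat))).
have kM : kermx M != 0.
  by rewrite -mxrank_eq0 mxrank_ker -lt0n subn_gt0 ltnS rank_leq_col.
pose a := nz_row (kermx M).
have a0 : a != 0 by rewrite nz_row_eq0.
have aM : a *m M = 0 by apply/sub_kermxP; exact: nz_row_sub.
pose x := \sum_i a 0 i *: eigvec S' (inl (i : nat)).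
have coef_sum (Q : eigensystem H) j n (F : 'I_n -> H) :
    coef ip Q j (\sum_i F i) = \sum_i coef ip Q j (F i).
  by rewrite /coef; case: ifP => _; rewrite ?ip_sumr // big1.
exists x; split.
- apply/eqP => x0; move/eqP: a0; apply; apply/rowP => i; rewrite [RHS]mxE.
  have : coef ip S' (inl (i : nat)) x = 0 by rewrite x0 /coef ip0r; case: ifP.
  rewrite coef_sum (bigD1 i) //= big1 ?addr0 => [|j ji].
    by rewrite coefZ (coef_eigvec HS') // eqxx mulr1.
  rewrite coefZ (coef_eigvec HS') // (inj_eq (@inl_inj _ _)) eq_sym.
  by rewrite (inj_eq val_inj) (negPf ji) mulr0.
- move=> l lk; rewrite coef_sum; have /rowP/(_ (Ordinal lk)) := aM.
  rewrite !mxE => E; rewrite -[RHS]E; apply: eq_bigr => i _.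
  by rewrite coefZ mxE.
- move=> i ii; rewrite coef_sum => xi.
  apply: contrapT => nl; move/eqP: xi; apply.
  rewrite big1 // => l _; rewrite coefZ (coef_eigvec HS') //.
  by case: eqP => [E|_]; [case: nl; exists (l : nat) => //; rewrite -ltnS|rewrite mulr0].
Qed.

(** * The weight T and the form of the perturbation *)

Section Perturbation.
Variables (R : realType) (H : completeNormedModType R) (ip : {dot H for idfun}).
Hypothesis Hip : norm_from ip.
Variables (A Ah : {linear H -> H}).
Hypotheses (cA : compact_operator A) (sA : selfadjoint ip A).
Hypotheses (cAh : compact_operator Ah) (sAh : selfadjoint ip Ah).
Variable S : eigensystem H.
Hypothesis HS : eigensystem_of ip A S.
Variable J : seq nat.
Hypotheses (J_uniq : uniq J) (J_nonempty : J <> [::]).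
Hypothesis J_idx : forall k : nat, k \in J -> idx S (inl k).
Hypothesis gap_gt0 : 0 < gap S J.

Local Notation coef := (coef ip S).
Local Notation phi := (eigvec S).
Local Notation lam := (eigval S).
Local Notation g := (gap S J).
Local Notation d := (dist_to S J).
Local Notation alpha := (alphaJ ip A Ah S J).
Local Notation P := (specproj ip S J).
Local Notation RH := (absR_half ip S J).
Local Notation T := (T_half ip S J).

Definition inJ (i : nat + nat) : bool := i \in [seq (inl k : nat + nat) | k <- J].

Lemma inJ_inl k : inJ (inl k) = (k \in J).
Proof. by rewrite /inJ mem_map // => x y []. Qed.

Lemma inJP i : reflect (exists2 k, k \in J & i = inl k) (inJ i).
Proof. exact: mapP. Qed.

Lemma outsideE i : (i \in outside S J) = (i \in idx S) && ~~ inJ i.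
Proof.
apply/idP/andP => [/set_mem[ii nJ]|[/set_mem ii nJ]].
  split; first exact: mem_set.
  by apply/negP => /inJP[k kJ E]; apply: nJ; exists k.
by apply: mem_set; split => //= -[k kJ E]; move/negP: nJ; apply; apply/inJP; exists k.
Qed.

Lemma gap_le k l : k \in J -> idx S l -> ~~ inJ l -> g <= `|lam (inl k) - lam l|.
Proof.
move=> kJ il nJ; apply: ge_inf; first by exists 0 => _ [x _ [y _ <-]].
exists k => //; exists l => //; apply: set_mem.
by rewrite outsideE mem_set.
Qed.

Lemma dist_le k i : k \in J -> d i <= `|lam i - lam (inl k)|.
Proof. by move=> kJ; rewrite /dist_to; apply: ge_bigmin_seq. Qed.

Lemma head_mem : head 0%N J \in J.
Proof. by move: J_nonempty; case: (J) => // a s _; rewrite mem_head. Qed.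

Lemma dist_ge x i : (forall k, k \in J -> x <= `|lam i - lam (inl k)|) -> x <= d i.
Proof.
move=> xd; have hJ := head_mem; rewrite /dist_to big_seq; 
elim/big_ind: _ => [|a b xa xb|k]; first exact: xd.
  by rewrite le_min xa.
exact: xd.
Qed.

Lemma gap_le_dist l : idx S l -> ~~ inJ l -> g <= d l.
Proof. by move=> il nJ; apply: dist_ge => k kJ; rewrite distrC gap_le. Qed.

Lemma eigval_bounded : exists2 C : R, 0 <= C & forall i, idx S i -> `|lam i| <= C.
Proof.
have [C C0 AC] := compact_operator_bounded cA.
exists C => // i ii; have [_ _ _ ev _] := HS.
by have := AC (phi i); rewrite ev // normrZ (norm_eigvec Hip HS) // !mulr1.
Qed.

(** The eigenvalues of T^{-1/2}. *)
Definition weight i : R := if inJ i then Num.sqrt g else Num.sqrt (d i).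
Definition T_half_inv x := multiplier ip S weight x.
Local Notation W := T_half_inv.

Lemma weight_gt0 i : idx S i -> 0 < weight i.
Proof.
rewrite /weight => ii; case: ifPn => nJ; rewrite sqrtr_gt0 //.
exact: lt_le_trans (gap_le_dist ii nJ).
Qed.

Lemma weight_ge i : idx S i -> Num.sqrt g <= weight i.
Proof. by rewrite /weight => ii; case: ifPn => // nJ; rewrite ler_wsqrtr // gap_le_dist. Qed.

Lemma sqrt_gap_gt0 : 0 < Num.sqrt g.
Proof. by rewrite sqrtr_gt0. Qed.

Lemma weight_bounded : exists2 C : R, 0 <= C & forall i, idx S i -> `|weight i| <= C.
Proof.
have [C C0 lamC] := eigval_bounded.
have hJ := head_mem.
exists (Num.sqrt g + Num.sqrt (C + C)) => [|i ii]; first by rewrite addr_ge0 ?sqrtr_ge0.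
rewrite (ger0_norm (ltW (weight_gt0 ii))) /weight.
case: ifPn => nJ; first by rewrite lerDl sqrtr_ge0.
rewrite -[leLHS]add0r lerD ?sqrtr_ge0 // ler_wsqrtr //.
apply: le_trans (dist_le i hJ) _; apply: le_trans (ler_normB _ _) _.
by apply: lerD; apply: lamC => //; exact: J_idx.
Qed.

Lemma coef_W i x : idx S i -> coef i (W x) = weight i * coef i x.
Proof. by have [C C0 wC] := weight_bounded => ii; rewrite (coef_multiplier Hip HS _ C0 wC). Qed.

Lemma coef_P i x : idx S i -> coef i (P x) = if inJ i then coef i x else 0.
Proof.
move=> ii; rewrite coefE // /specproj ip_sumr.
have E (k : nat) : ip (phi i) (eigproj ip S (inl k) x) = if inl k == i then coef i x else 0.
  rewrite (eigprojE ip S) ipZr -(coefE _ _ ii).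
  have [ik|nk] := pselect (idx S (inl k)).
    by rewrite (coef_eigvec HS) // eq_sym; case: eqP => [->|_]; rewrite ?mulr1 ?mulr0.
  by rewrite (coefN ip x nk) mul0r; case: eqP => // Ei; rewrite Ei in nk.
under eq_bigr do rewrite E.
rewrite -big_mkcond -big_filter; case: ifPn => [/inJP[k kJ ->]|nJ].
  rewrite (@eq_filter _ _ (pred1 k)) => [|j]; last by rewrite /= (inj_eq (@inl_inj _ _)).
  by rewrite filter_pred1_uniq // big_seq1.
rewrite (_ : [seq _ <- _ | _] = [::]) ?big_nil //; apply/eqP.
rewrite -(negbK (_ == _)) -has_filter; apply/hasPn => k kJ.
by apply: contraNN nJ => /eqP <-; rewrite inJ_inl.
Qed.

Lemma coef_R i x : idx S i ->
  coef i (RH x) = if inJ i then 0 else (Num.sqrt (d i))^-1 * coef i x.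
Proof.
move=> ii; pose w i := if i \in outside S J then (Num.sqrt (d i))^-1 else 0.
have -> : RH x = multiplier ip S w x.
  rewrite /absR_half /multiplier; congr (summability.sum _); apply/funext => j.
  by rewrite /w; case: ifP; rewrite // scale0r.
have C0 : 0 <= (Num.sqrt g)^-1 by rewrite invr_ge0 sqrtr_ge0.
have wC j : idx S j -> `|w j| <= (Num.sqrt g)^-1.
  rewrite /w outsideE => jj; rewrite mem_set //=; case: ifPn => nJ; last by rewrite normr0.
  rewrite normfV (ger0_norm (sqrtr_ge0 _)) lef_pV2 ?posrE ?sqrt_gap_gt0 //.
    by rewrite ler_wsqrtr // gap_le_dist.
  by rewrite sqrtr_gt0; apply: lt_le_trans (gap_le_dist jj nJ).
rewrite (coef_multiplier Hip HS _ C0 wC ii) /w outsideE mem_set //=.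
by case: (inJ i); rewrite /= ?mul0r.
Qed.

Lemma coef_T i x : idx S i -> coef i (T x) = (weight i)^-1 * coef i x.
Proof.
move=> ii; rewrite /T_half coefD coefZ coef_P // coef_R // /weight.
by case: ifPn => _; rewrite ?mulr0 ?addr0 ?add0r.
Qed.

Lemma TZ a x : T (a *: x) = a *: T x.
Proof. by apply: (coef_inj Hip HS) => i ii; rewrite coefZ !coef_T // coefZ mulrCA. Qed.

Lemma WD x y : W (x + y) = W x + W y.
Proof. by apply: (coef_inj Hip HS) => i ii; rewrite coefD !coef_W // coefD mulrDr. Qed.

Lemma RD x y : RH (x + y) = RH x + RH y.
Proof.
apply: (coef_inj Hip HS) => i ii; rewrite coefD !coef_R // coefD.
by case: ifP; rewrite ?addr0 ?mulrDr.
Qed.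

Lemma RB x y : RH (x - y) = RH x - RH y.
Proof.
apply: (coef_inj Hip HS) => i ii; rewrite coefB !coef_R // coefB.
by case: ifP; rewrite ?subr0 ?mulrBr.
Qed.

Lemma TW x : T (W x) = x.
Proof.
apply: (coef_inj Hip HS) => i ii; rewrite coef_T // coef_W //.
by rewrite mulKf // gt_eqF // weight_gt0.
Qed.

Lemma T_sym x y : ip (T x) y = ip x (T y).
Proof. by apply: (ip_eq_coef Hip HS) => i ii; rewrite !coef_T // mulrCA mulrA. Qed.

Lemma T_le x : `|T x| <= (Num.sqrt g)^-1 * `|x|.
Proof.
apply: (norm_le_coef Hip HS) => [|i ii]; first by rewrite invr_ge0 sqrtr_ge0.
rewrite coef_T // normrM ler_wpM2r // normfV gtr0_norm ?weight_gt0 //.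
by rewrite lef_pV2 ?posrE ?weight_gt0 ?sqrt_gap_gt0 // weight_ge.
Qed.

Lemma TET_le x : `|T ((Ah \- A) (T x))| <= alpha * `|x|.
Proof.
have [C1 C10 AC] := compact_operator_bounded cA.
have [C2 C20 AhC] := compact_operator_bounded cAh.
pose s := (Num.sqrt g)^-1; have s0 : 0 <= s by rewrite invr_ge0 sqrtr_ge0.
have EC z : `|(Ah \- A) z| <= (C2 + C1) * `|z|.
  rewrite /= mulrDl; apply: le_trans (ler_normB _ _) _; exact: lerD.
apply: (@opnorm_bound _ _ (T \o (Ah \- A) \o T) (s * ((C2 + C1) * s))).
  move=> a z; rewrite -[RHS]TZ /= TZ; congr T.
  by rewrite scalerBr -!linearZ.
move=> z; rewrite /=; apply: le_trans (T_le _) _; rewrite -mulrA ler_wpM2l //.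
apply: le_trans (EC _) _; rewrite -mulrA ler_wpM2l ?addr_ge0 //; exact: T_le.
Qed.

Lemma alpha_ge0 : 0 <= alpha.
Proof.
have hJ := head_mem.
have := TET_le (phi (inl (head 0%N J))).
by rewrite (norm_eigvec Hip HS (J_idx hJ)) mulr1; apply: le_trans.
Qed.

(** This is how alpha enters: E = T^{-1/2} (T^{1/2} E T^{1/2}) T^{-1/2}. *)
Lemma form_le_alphaJ u v : `|ip ((Ah \- A) u) v| <= alpha * `|W u| * `|W v|.
Proof.
rewrite -[X in ip _ X]TW -T_sym; apply: le_trans (ip_CauchySchwarz Hip _ _) _.
by rewrite ler_wpM2r // -[X in T (_ X)]TW; exact: TET_le.
Qed.

Lemma W_norm_ge x : Num.sqrt g * `|x| <= `|W x|.
Proof.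
have s0 := sqrt_gap_gt0; rewrite -ler_pdivlMl // .
apply: (norm_le_coef Hip HS) => [|i ii]; first by rewrite invr_ge0 ltW.
rewrite coef_W // normrM ler_pdivlMl // ler_wpM2r // ger0_norm ?weight_ge //.
exact: ltW (weight_gt0 ii).
Qed.

Lemma W_P_le x : `|W (P x)| <= Num.sqrt g * `|P x|.
Proof.
apply: (norm_le_coef Hip HS) => [|i ii]; first exact: sqrtr_ge0.
rewrite coef_W // coef_P // normrM /weight.
by case: ifP => _; rewrite ?normr0 ?mulr0 // ger0_norm ?sqrtr_ge0.
Qed.

Lemma P_norm_le x : `|P x| <= `|x|.
Proof.
rewrite -[leRHS]mul1r; apply: (norm_le_coef Hip HS) => // i ii.
by rewrite coef_P // mul1r; case: ifP => // _; rewrite normr0.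
Qed.

Definition specproj_compl x := x - P x.
Local Notation Q := specproj_compl.

Lemma coef_Q i x : idx S i -> coef i (Q x) = if inJ i then 0 else coef i x.
Proof. by move=> ii; rewrite /specproj_compl coefB coef_P //; case: ifP; rewrite ?subrr ?subr0. Qed.

Lemma Q_norm_le x : `|Q x| <= `|x|.
Proof.
rewrite -[leRHS]mul1r; apply: (norm_le_coef Hip HS) => // i ii.
by rewrite coef_Q // mul1r; case: ifP => // _; rewrite normr0.
Qed.

Lemma QD x y : Q (x + y) = Q x + Q y.
Proof.
apply: (coef_inj Hip HS) => i ii; rewrite [RHS]coefD !coef_Q // coefD.
by case: ifP; rewrite ?addr0.
Qed.

Lemma QZ a x : Q (a *: x) = a *: Q x.
Proof.
by apply: (coef_inj Hip HS) => i ii; rewrite coefZ !coef_Q // coefZ; case: ifP; rewrite ?mulr0.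
Qed.

Lemma Q0 : Q 0 = 0.
Proof. by rewrite -[X in Q X](scale0r 0) QZ scale0r. Qed.

Lemma P_sym x y : ip (P x) y = ip x (P y).
Proof.
apply: (ip_eq_coef Hip HS) => i ii; rewrite !coef_P //.
by case: ifP; rewrite ?mul0r ?mulr0.
Qed.

Lemma PP x : P (P x) = P x.
Proof. by apply: (coef_inj Hip HS) => i ii; rewrite !coef_P //; case: (inJ i). Qed.

Lemma R_sym x y : ip (RH x) y = ip x (RH y).
Proof.
apply: (ip_eq_coef Hip HS) => i ii; rewrite !coef_R //.
by case: ifP; rewrite ?mul0r ?mulr0 // mulrCA mulrA.
Qed.

Lemma weight_out i : ~~ inJ i -> weight i = Num.sqrt (d i).
Proof. by rewrite /weight => /negPf ->. Qed.

Lemma R_le x : `|RH x| <= (Num.sqrt g)^-1 * `|x|.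
Proof.
apply: (norm_le_coef Hip HS) => [|i ii]; first by rewrite invr_ge0 sqrtr_ge0.
rewrite coef_R //; case: ifPn => [_|nJ].
  by rewrite normr0 mulr_ge0 // invr_ge0 sqrtr_ge0.
rewrite -weight_out // normrM ler_wpM2r // normfV gtr0_norm ?weight_gt0 //.
by rewrite lef_pV2 ?posrE ?weight_gt0 ?sqrt_gap_gt0 // weight_ge.
Qed.

Lemma W_R_R_le x : `|W (RH (RH x))| <= `|RH x|.
Proof.
rewrite -[leRHS]mul1r; apply: (norm_le_coef Hip HS) => // i ii.
rewrite mul1r coef_W // (coef_R (RH x)) //; case: ifPn => nJ; first by rewrite mulr0 normr0.
by rewrite -weight_out // mulrA divff ?mul1r // gt_eqF // weight_gt0.
Qed.

Lemma ip_R_W x y : ip (RH x) (W (Q y)) = ip x (Q y).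
Proof.
apply: (ip_eq_coef Hip HS) => i ii; rewrite coef_R // coef_W // coef_Q //.
case: ifPn => nJ; first by rewrite mul0r mulr0.
by rewrite -weight_out // mulrACA mulVf ?mul1r // gt_eqF // weight_gt0.
Qed.

(** Duality: test the form of E against |R|^{1/2} |R|^{1/2} E u. *)
Lemma R_E_le u : `|RH ((Ah \- A) u)| <= alpha * `|W u|.
Proof.
set z := (Ah \- A) u; have [z0|z0] := eqVneq `|RH z| 0.
  by rewrite z0 mulr_ge0 ?alpha_ge0.
have zp : 0 < `|RH z| by rewrite lt_neqAle eq_sym z0 /=.
rewrite -(ler_pM2r zp) -expr2 Hip R_sym; apply: le_trans (ler_norm _) _.
apply: le_trans (form_le_alphaJ _ _) _; rewrite ler_wpM2l ?W_R_R_le //.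
by rewrite mulr_ge0 ?alpha_ge0.
Qed.

Lemma P_E_le u : `|P ((Ah \- A) u)| <= alpha * Num.sqrt g * `|W u|.
Proof.
set z := (Ah \- A) u; have [z0|z0] := eqVneq `|P z| 0.
  by rewrite z0 !mulr_ge0 ?alpha_ge0 ?sqrtr_ge0.
have zp : 0 < `|P z| by rewrite lt_neqAle eq_sym z0 /=.
rewrite -(ler_pM2r zp) -expr2 Hip P_sym PP; apply: le_trans (ler_norm _) _.
apply: le_trans (form_le_alphaJ _ _) _.
rewrite [leRHS](_ : _ = alpha * `|W u| * (Num.sqrt g * `|P z|)); last by ring.
by rewrite ler_wpM2l ?W_P_le // mulr_ge0 ?alpha_ge0.
Qed.

(** For l outside J the l-th coefficients satisfy
    (theta - lam_l) u_l = (E u - r)_l; dividing by the square root of dist(lam_l) turns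
    the spectral distance into the weight. *)
Lemma resolvent_bound u r (theta kappa : R) : 0 <= kappa -> Ah u = theta *: u + r ->
  (forall l, idx S l -> ~~ inJ l -> kappa * d l <= `|theta - lam l|) ->
  kappa * `|W (Q u)| <= `|RH ((Ah \- A) u - r)|.
Proof.
move=> k0 Ahu kd; rewrite -[kappa in leLHS](ger0_norm k0) -normrZ -[leRHS]mul1r.
apply: (norm_le_coef Hip HS) => // i ii.
rewrite mul1r coefZ coef_W // coef_Q // coef_R //; case: ifPn => nJ.
  by rewrite !mulr0.
rewrite /= Ahu addrAC addrK coefB coefZ (coef_A HS) // -mulrBl.
have d0 : 0 < d i := lt_le_trans gap_gt0 (gap_le_dist ii nJ).
rewrite mulrA mulrA !normrM ler_wpM2r // weight_out // normfV.
rewrite (ger0_norm k0) (ger0_norm (sqrtr_ge0 _)) ler_pdivlMl ?sqrtr_gt0 //.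
by rewrite mulrCA -expr2 sqr_sqrtr ?kd // ltW.
Qed.

(** * Localization of the perturbed eigenvalues and eigenvectors *)

Section Aligned.
Hypotheses (pA : nonneg_eigenvalues A) (pAh : nonneg_eigenvalues Ah).
Variable Sh : eigensystem H.
Hypothesis HSh : eigensystem_of ip Ah Sh.
Hypothesis Jh_idx : forall k : nat, k \in J -> idx Sh (inl k).
Hypothesis alpha_le : alpha <= 1 / 4.
Local Notation lamh := (eigval Sh).
Local Notation phih := (eigvec Sh).

Lemma sqrt_gap_sqr : Num.sqrt g ^+ 2 = g.
Proof. by rewrite sqr_sqrtr // ltW. Qed.

(** The perturbed form is at most that of A + alpha T^{-1}, which is diagonal with
    values lam_i + alpha g on J and lam_i + alpha dist(lam_i) off J.  For alpha <= 1 none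
    of those with lam_i <= lam_k exceeds lam_k + alpha g, as dist(lam_i) is at most
    lam_k - lam_i; min-max concludes. *)
Lemma weyl_upper k : k \in J -> lamh (inl k) <= lam (inl k) + alpha * g.
Proof.
move=> kJ; have [x [x0 xk xkh]] := minmax_test_vector Hip S HSh (Jh_idx kJ).
have x2 : 0 < `|x| ^+ 2 by rewrite exprn_gt0 // normr_gt0.
rewrite -(ler_pM2r x2); apply: le_trans (rayleigh_ge Hip HSh sAh (Jh_idx kJ) xkh) _.
have -> : Ah x = A x + (Ah \- A) x by rewrite /= addrC subrK.
rewrite ipDl; have := form_le_alphaJ x x; move=> /(le_trans (ler_norm _)) E.
have : 0 <= ip ((lam (inl k) + alpha * g) *: x - A x) x + ip (- alpha *: W x) (W x).
  apply: (ip2_ge0 Hip HS) => i ii; rewrite coefB !coefZ (coef_A HS) // coef_W //.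
  have [->|c0] := eqVneq (coef i x) 0; first by rewrite !mulr0 addr0.
  have lik : lam i <= lam (inl k).
    apply: (eigval_le_above Hip HS pA (J_idx kJ) ii) => l il.
    rewrite leqNgt; apply/negP => lk; move/eqP: c0; apply; rewrite il; exact: xk.
  rewrite (_ : _ + _ = (lam (inl k) + alpha * g - lam i - alpha * weight i ^+ 2) *
    coef i x ^+ 2); last by ring.
  rewrite mulr_ge0 ?sqr_ge0 // /weight; case: ifPn => nJ; first by rewrite sqrt_gap_sqr; lra.
  have d0 : 0 < d i := lt_le_trans gap_gt0 (gap_le_dist ii nJ).
  rewrite (sqr_sqrtr (ltW d0)); have := dist_le i kJ.
  rewrite distrC ger0_norm ?subr_ge0 // => di; have a0 := alpha_ge0; have a1 := alpha_le.
  have ag : 0 <= alpha * g by rewrite mulr_ge0 // ltW.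
  have : alpha * d i <= 1 * d i by apply: ler_wpM2r; [exact: ltW|lra].
  lra.
rewrite ipBl !ipZl -!Hip; lra.
Qed.

Lemma weyl_lower k : k \in J -> lam (inl k) - alpha * g <= lamh (inl k).
Proof.
move=> kJ; have [x [x0 xk xkh]] := minmax_test_vector Hip Sh HS (J_idx kJ).
have x2 : 0 < `|x| ^+ 2 by rewrite exprn_gt0 // normr_gt0.
rewrite -(ler_pM2r x2); apply: le_trans (rayleigh_le Hip HSh sAh pAh (Jh_idx kJ) xk).
have -> : Ah x = A x + (Ah \- A) x by rewrite /= addrC subrK.
rewrite ipDl; have := form_le_alphaJ x x; rewrite ler_norml => /andP[E _].
have : 0 <= ip (A x - (lam (inl k) - alpha * g) *: x) x + ip (- alpha *: W x) (W x).
  apply: (ip2_ge0 Hip HS) => i ii; rewrite coefB !coefZ (coef_A HS) // coef_W //.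
  have [->|c0] := eqVneq (coef i x) 0; first by rewrite !mulr0 addr0.
  have lik : lam (inl k) <= lam i.
    have [l lk ->] := xkh i ii c0; have [mono _ _ _ _] := HS.
    exact: (mono _ _ lk (J_idx kJ)).2.
  rewrite (_ : _ + _ = (lam i - (lam (inl k) - alpha * g) - alpha * weight i ^+ 2) *
    coef i x ^+ 2); last by ring.
  rewrite mulr_ge0 ?sqr_ge0 // /weight; case: ifPn => nJ; first by rewrite sqrt_gap_sqr; lra.
  have d0 : 0 < d i := lt_le_trans gap_gt0 (gap_le_dist ii nJ).
  rewrite (sqr_sqrtr (ltW d0)); have := dist_le i kJ.
  rewrite ger0_norm ?subr_ge0 // => di; have a0 := alpha_ge0; have a1 := alpha_le.
  have ag : 0 <= alpha * g by rewrite mulr_ge0 // ltW.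
  have : alpha * d i <= 1 * d i by apply: ler_wpM2r; [exact: ltW|lra].
  lra.
rewrite ipBl !ipZl -!Hip; lra.
Qed.

Lemma weyl k : k \in J -> `|lamh (inl k) - lam (inl k)| <= alpha * g.
Proof.
move=> kJ; rewrite ler_norml; have := weyl_upper kJ; have := weyl_lower kJ.
by move=> *; apply/andP; split; lra.
Qed.

(** [resolvent_bound] with kappa = 1 - alpha; splitting psih_k into its P and Q parts
    puts alpha times the left-hand side on the right, and it is absorbed as
    1 - 2 alpha >= 1/2. *)
Lemma Q_eigvec_bound k : k \in J ->
  `|W (Q (phih (inl k)))| <= 2 * `|RH ((Ah \- A) (P (phih (inl k))))|.
Proof.
move=> kJ; set u := phih (inl k).
have a0 := alpha_ge0; have a1 := alpha_le.
have Ahu : Ah u = lamh (inl k) *: u + 0.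
  by have [_ _ _ ev _] := HSh; rewrite addr0 ev //; exact: Jh_idx.
have k0 : 0 <= 1 - alpha by lra.
have := resolvent_bound k0 Ahu; rewrite subr0 => res.
have {}res : (1 - alpha) * `|W (Q u)| <= `|RH ((Ah \- A) u)|.
  apply: res => l il nJ.
  have h1 : `|lam l - lam (inl k)| <=
      `|lamh (inl k) - lam l| + `|lamh (inl k) - lam (inl k)|.
    by rewrite (distrC _ (lam l)); exact: ler_distD.
  have h2 := dist_le l kJ; have h3 := weyl kJ; have h4 := gap_le_dist il nJ.
  have h5 : alpha * g <= alpha * d l by rewrite ler_wpM2l.
  lra.
have uE : (Ah \- A) u = (Ah \- A) (P u) + (Ah \- A) (Q u).
  rewrite -linearD /specproj_compl addrC subrK //.
have := ler_normD (RH ((Ah \- A) (P u))) (RH ((Ah \- A) (Q u))).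
rewrite -RD -uE => h; have h2 := R_E_le (Q u).
have W0 := normr_ge0 (W (Q u)).
have : alpha * `|W (Q u)| <= 1 / 4 * `|W (Q u)| by rewrite ler_wpM2r.
lra.
Qed.

(** An approximate eigenvector at the exact eigenvalue lam_k: here kappa = 1, and both
    E u and r contribute alpha times the square root of g, the term alpha |W Q u| is
    absorbed on the left, and 2 / (1 - alpha) is at most 8/3. *)
Lemma Q_cluster_bound k u r : k \in J -> Ah u = lam (inl k) *: u + r ->
  `|r| <= alpha * g * `|u| -> `|Q u| <= 8 / 3 * alpha * `|u|.
Proof.
move=> kJ Ahu rb; have a0 := alpha_ge0; have a1 := alpha_le; have s0 := sqrt_gap_gt0.
have res : 1 * `|W (Q u)| <= `|RH ((Ah \- A) u - r)|.
  apply: (resolvent_bound _ Ahu) => // l il nJ.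
  by rewrite mul1r distrC dist_le.
rewrite mul1r RB in res.
have {}res := le_trans res (ler_normB _ _).
have rr : `|RH r| <= alpha * Num.sqrt g * `|u|.
  apply: le_trans (R_le _) _; rewrite ler_pdivrMl //; apply: le_trans rb _.
  by rewrite -[X in _ * X * _]sqrt_gap_sqr le_eqVlt; apply/orP; left; apply/eqP; ring.
have uE : u = P u + Q u by rewrite /specproj_compl addrC subrK.
have Wu : `|W u| <= Num.sqrt g * `|u| + `|W (Q u)|.
  rewrite [X in W X]uE WD; apply: le_trans (ler_normD _ _) _; rewrite lerD2r.
  by apply: le_trans (W_P_le _) _; rewrite ler_wpM2l ?P_norm_le // ltW.
have h1 := R_E_le u; have h2 := ler_wpM2l a0 Wu.
have h3 : alpha * `|W (Q u)| <= 1 / 4 * `|W (Q u)| by rewrite ler_wpM2r.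
have h4 : `|W (Q u)| <= Num.sqrt g * (8 / 3 * alpha * `|u|) by lra.
by rewrite -(ler_pM2l s0); apply: le_trans h4; exact: W_norm_ge.
Qed.

(** * The frame matrix of the perturbed eigenvectors *)

Local Notation n := (size J).
Local Notation beta := (betaJ ip A Ah S J).
Let elt (a : 'I_n) : nat := nth 0%N J a.
Let psi (a : 'I_n) : H := phi (inl (elt a)).
Let psih (a : 'I_n) : H := phih (inl (elt a)).
Let E x := (Ah \- A) x.

Lemma elt_mem a : elt a \in J.
Proof. exact: mem_nth. Qed.

Lemma elt_inj : injective elt.
Proof. by move=> a b /eqP; rewrite nth_uniq // => /eqP /val_inj. Qed.

Lemma psi_orthonormal a b : ip (psi a) (psi b) = (a == b)%:R.
Proof.
have [_ _ on _ _] := HS.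
rewrite on; [|exact: J_idx (elt_mem a)|exact: J_idx (elt_mem b)].
by rewrite (inj_eq (@inl_inj _ _)) (inj_eq elt_inj).
Qed.

Lemma psih_orthonormal a b : ip (psih a) (psih b) = (a == b)%:R.
Proof.
have [_ _ on _ _] := HSh.
rewrite on; [|exact: Jh_idx (elt_mem a)|exact: Jh_idx (elt_mem b)].
by rewrite (inj_eq (@inl_inj _ _)) (inj_eq elt_inj).
Qed.

Lemma perturbation_sym x y : ip (E x) y = ip x (E y).
Proof. by rewrite /E /= ipBl ipBr sA sAh. Qed.

Lemma sum_over_J (V : nmodType) (F : nat -> V) : \sum_(k <- J) F k = \sum_a F (elt a).
Proof. by rewrite (big_nth 0%N) big_mkord. Qed.

Lemma P_expand x : P x = \sum_a ip (psi a) x *: psi a.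
Proof.
rewrite /specproj sum_over_J; apply: eq_bigr => a _.
by rewrite (eigprojE ip S) coefE //; exact: J_idx (elt_mem a).
Qed.

Lemma orthonormal_norm2 (f : 'I_n -> H) (v : 'I_n -> R) :
  (forall a b, ip (f a) (f b) = (a == b)%:R) ->
  `|\sum_a v a *: f a| ^+ 2 = \sum_a v a ^+ 2.
Proof.
move=> on; rewrite Hip ip_suml; apply: eq_bigr => a _.
rewrite ip_sumr (bigD1 a) //= big1 => [|b ba]; rewrite ipZl ipZr on ?eqxx.
  by rewrite mulr1 addr0 expr2.
by rewrite eq_sym (negPf ba) !mulr0.
Qed.

Lemma bessel (f : 'I_n -> H) x : (forall a b, ip (f a) (f b) = (a == b)%:R) ->
  \sum_a ip (f a) x ^+ 2 <= `|x| ^+ 2.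
Proof.
move=> on; set p := \sum_a ip (f a) x *: f a.
have pp : `|p| ^+ 2 = \sum_a ip (f a) x ^+ 2 := orthonormal_norm2 _ on.
have px : ip p x = \sum_a ip (f a) x ^+ 2.
  by rewrite ip_suml; apply: eq_bigr => a _; rewrite ipZl expr2.
have : 0 <= `|x - p| ^+ 2 by exact: sqr_ge0.
rewrite Hip ipBl !ipBr (ipC ip x p) -!Hip px pp; lra.
Qed.

Lemma P_norm2 x : `|P x| ^+ 2 = \sum_a ip (psi a) x ^+ 2.
Proof. by rewrite P_expand (orthonormal_norm2 _ psi_orthonormal). Qed.

Lemma hs_norm_betaJ : \sum_a `|RH (E (psi a))| ^+ 2 = g * beta ^+ 2.
Proof.
pose f i : \bar R := (`|(RH \o (Ah \- A) \o P) (phi i)| ^+ 2)%:E.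
have Pphi i : idx S i -> P (phi i) = if inJ i then phi i else 0.
  move=> ii; apply: (coef_inj Hip HS) => j jj; rewrite coef_P //.
  rewrite (coef_eigvec HS) //; case: (eqVneq j i) => [->|ji].
    case: ifP => _; first by rewrite (coef_eigvec HS) // eqxx.
    by rewrite /coef ip0r; case: ifP.
  by case: ifP => _; case: ifP => _;
    rewrite ?(coef_eigvec HS) ?(negPf ji) // /coef ip0r; case: ifP.
have R0 : RH 0 = 0 by rewrite -[X in RH X](subrr 0) RB subrr.
have hsE : fine (esum (idx S) f) = \sum_a `|RH (E (psi a))| ^+ 2.
  pose JJ := [set` [seq (inl k : nat + nat) | k <- J]].
  have JS : idx S `&` JJ = JJ.
    apply/seteqP; split=> [i [] //|i iJ]; split=> //.
    by have [k kJ ->] := mapP iJ; exact: J_idx.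
  have -> : esum (idx S) f = esum (idx S `&` JJ) f.
    rewrite esum_mkcondr; apply: eq_esum => i ii.
    rewrite (_ : (i \in JJ) = inJ i); last first.
      by apply/idP/idP => [/set_mem|iJ] //; exact: mem_set.
    case: ifPn => // nJ; rewrite /f /= Pphi // (negPf nJ).
    by rewrite (linear0 Ah) (linear0 A) subr0 R0 normr0 expr0n.
  have fin : finite_set JJ by exact: finite_seq.
  have f0 i : i \in JJ -> (0 <= f i)%E by move=> _; rewrite lee_fin sqr_ge0.
  rewrite JS (esum_fset fin f0).
  rewrite -fsbig_seq ?map_inj_uniq //; last exact: inl_inj.
  rewrite big_map sum_over_J sumEFin /=; apply: eq_bigr => a _.
  rewrite Pphi; last exact: J_idx (elt_mem a).
  by rewrite inJ_inl elt_mem.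
rewrite /betaJ exprMn /hsnorm exprVn sqrt_gap_sqr mulrA mulfV ?gt_eqF // mul1r.
by rewrite sqr_sqrtr hsE //; apply: sumr_ge0 => a _; exact: sqr_ge0.
Qed.

Lemma beta_ge0 : 0 <= beta.
Proof. by rewrite /betaJ /hsnorm mulr_ge0 ?invr_ge0 ?sqrtr_ge0. Qed.

Let tilt a := Q (psih a).

(** The coefficients of the perturbed eigenvectors in the frame psi form a contraction,
    which cannot increase a Hilbert-Schmidt norm: coefficientwise this is the
    inequality of Bessel. *)
Lemma RE_P_frame : \sum_a `|RH (E (P (psih a)))| ^+ 2 <= g * beta ^+ 2.
Proof.
rewrite -hs_norm_betaJ; apply: (sum_norm_le Hip HS) => i ii.
have ER z : coef i (RH (E z)) =
    (if inJ i then 0 else (Num.sqrt (d i))^-1) * ip (E (phi i)) z.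
  by rewrite coef_R // coefE // perturbation_sym; case: ifP; rewrite ?mul0r.
under eq_bigr do rewrite ER -P_sym exprMn.
under [leRHS]eq_bigr do rewrite ER exprMn.
rewrite -!mulr_sumr ler_wpM2l ?sqr_ge0 //.
under eq_bigr do rewrite (ipC ip).
under [leRHS]eq_bigr do rewrite (ipC ip).
by rewrite -P_norm2; exact: bessel psih_orthonormal.
Qed.

Lemma weighted_tilt_hs : \sum_a `|W (tilt a)| ^+ 2 <= 4 * (g * beta ^+ 2).
Proof.
apply: le_trans (ler_wpM2l _ RE_P_frame) => //; rewrite mulr_sumr.
apply: ler_sum => a _; rewrite (_ : 4 = 2 ^+ 2); last by ring.
by rewrite -exprMn ler_pXn2r ?nnegrE ?mulr_ge0 // Q_eigvec_bound // elt_mem.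
Qed.

Lemma tilt_hs : \sum_a `|tilt a| ^+ 2 <= 4 * beta ^+ 2.
Proof.
rewrite -(ler_pM2l gap_gt0) [leRHS]mulrCA; apply: le_trans weighted_tilt_hs.
rewrite mulr_sumr; apply: ler_sum => a _.
by rewrite -[X in X * _]sqrt_gap_sqr -exprMn ler_pXn2r ?nnegrE ?mulr_ge0 ?sqrtr_ge0 ?W_norm_ge.
Qed.

Lemma tilt_op_le1 (v : 'I_n -> R) : `|\sum_a v a *: tilt a| <= 1 * Num.sqrt (\sum_a v a ^+ 2).
Proof.
have -> : \sum_a v a *: tilt a = Q (\sum_a v a *: psih a).
  rewrite (big_morph Q (id1 := 0) (op1 := +%R) QD Q0); apply: eq_bigr => a _.
  by rewrite QZ.
apply: le_trans (Q_norm_le _) _.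
by rewrite mul1r -(orthonormal_norm2 v psih_orthonormal) sqrtr_sqr ger0_norm.
Qed.

Local Notation D := ((size (distinct_eigvals S J))%:R : R).

(** The combination is split according to the value of lam.  On each piece u_t the
    perturbed operator acts as t up to alpha g by [weyl], so that [Q_cluster_bound]
    applies; the norms of the pieces are summed by Cauchy-Schwarz, which costs the
    square root of their number. *)
Lemma tilt_op_le_alpha (v : 'I_n -> R) : `|\sum_a v a *: tilt a| <=
  8 / 3 * alpha * Num.sqrt D * Num.sqrt (\sum_a v a ^+ 2).
Proof.
set th := distinct_eigvals S J.
have th_uniq : uniq th by rewrite sort_uniq undup_uniq.
have th_mem a : lam (inl (elt a)) \in th.
  by rewrite mem_sort mem_undup; apply/mapP; exists (elt a); rewrite ?elt_mem.
have split_th (V : nmodType) (F : 'I_n -> V) :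
    \sum_a F a = \sum_(t <- th) \sum_(a | lam (inl (elt a)) == t) F a.
  under [RHS]eq_bigr do rewrite big_mkcond.
  rewrite exchange_big; apply: eq_bigr => a _ /=.
  rewrite -big_mkcond -big_filter (@eq_filter _ _ (pred1 (lam (inl (elt a))))).
    by rewrite filter_pred1_uniq // big_seq1.
  by move=> t; rewrite eq_sym.
pose u t := \sum_(a | lam (inl (elt a)) == t) v a *: psih a.
pose s t := \sum_(a | lam (inl (elt a)) == t) v a ^+ 2.
have s0 t : 0 <= s t by apply: sumr_ge0 => a _; exact: sqr_ge0.
have cond_norm (w : 'I_n -> R) (t : R) :
    `|\sum_(a | lam (inl (elt a)) == t) w a *: psih a| ^+ 2 =
    \sum_(a | lam (inl (elt a)) == t) w a ^+ 2.
  pose w' a := if lam (inl (elt a)) == t then w a else 0.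
  have -> : \sum_(a | lam (inl (elt a)) == t) w a *: psih a = \sum_a w' a *: psih a.
    by rewrite big_mkcond; apply: eq_bigr => a _; rewrite /w'; case: ifP; rewrite ?scale0r.
  rewrite (orthonormal_norm2 _ psih_orthonormal) [RHS]big_mkcond; apply: eq_bigr => a _.
  by rewrite /w'; case: ifP; rewrite ?expr0n.
have Qu t : t \in th -> `|Q (u t)| <= 8 / 3 * alpha * Num.sqrt (s t).
  rewrite mem_sort mem_undup => /mapP[k kJ tE].
  have ut : `|u t| = Num.sqrt (s t) by rewrite /s -cond_norm sqrtr_sqr ger0_norm.
  rewrite -ut; pose c a := (lamh (inl (elt a)) - t) * v a.
  apply: (@Q_cluster_bound k _ (\sum_(a | lam (inl (elt a)) == t) c a *: psih a)) => //.
    rewrite /u linear_sum scaler_sumr -big_split; apply: eq_bigr => a _ /=.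
    have [_ _ _ ev _] := HSh; rewrite linearZ /= ev; last exact: Jh_idx (elt_mem a).
    by rewrite !scalerA -scalerDl -tE; congr (_ *: _); rewrite /c; ring.
  have ag0 : 0 <= alpha * g by rewrite mulr_ge0 ?alpha_ge0 // ltW.
  have rhs0 : 0 <= alpha * g * `|u t| by exact: mulr_ge0.
  rewrite -(@ler_pXn2r _ 2) ?nnegrE // exprMn cond_norm /u cond_norm.
  rewrite mulr_sumr; apply: ler_sum => a /eqP at'.
  rewrite /c exprMn ler_wpM2r ?sqr_ge0 // -real_normK ?num_real //.
  by rewrite ler_pXn2r ?nnegrE // -at' weyl // elt_mem.
have -> : \sum_a v a *: tilt a = \sum_(t <- th) Q (u t).
  rewrite split_th; apply: eq_bigr => t _.
  rewrite /u (big_morph Q (id1 := 0) (op1 := +%R) QD Q0); apply: eq_bigr => a _.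
  by rewrite QZ.
apply: le_trans (ler_norm_sum _ _ _) _.
apply: (@le_trans _ _ (\sum_(t <- th) 8 / 3 * alpha * Num.sqrt (s t))).
  by rewrite big_seq [leRHS]big_seq; apply: ler_sum => t; exact: Qu.
rewrite -mulr_sumr -[leRHS]mulrA ler_wpM2l ?mulr_ge0 ?alpha_ge0 //.
rewrite -sqrtrM // split_th -/(s _).
have sum0 : 0 <= \sum_(t <- th) Num.sqrt (s t).
  by apply: sumr_ge0 => t _; exact: sqrtr_ge0.
rewrite -[leLHS](ger0_norm sum0) -sqrtr_sqr ler_wsqrtr //.
have nthE (F : R -> R) : \sum_(t <- th) F t = \sum_(i < size th) F (nth 0 th i).
  by rewrite (big_nth 0) big_mkord.
rewrite !nthE.
have := sum_CauchySchwarz (fun=> 1)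
  (fun i : 'I_(size th) => Num.sqrt (s (nth 0 th i))).
under eq_bigr do rewrite mul1r.
under [X in _ <= X * _ -> _]eq_bigr do rewrite expr1n.
rewrite sumr_const card_ord; under [X in _ <= _ * X -> _]eq_bigr do rewrite sqr_sqrtr //.
by [].
Qed.

Let K : 'M[R]_n := \matrix_(i, a) ip (psi i) (psih a).
Let N : 'M[R]_n := compression ip (Ah \- A) S J.
Let lamr : 'rV[R]_n := \row_a lam (inl (elt a)).
Let lamhr : 'rV[R]_n := \row_a lamh (inl (elt a)).

Lemma N_entry i j : N i j = ip (E (psi i)) (psi j).
Proof. by rewrite mxE. Qed.

Lemma N_sym : N^T = N.
Proof. by apply/matrixP => i j; rewrite mxE !N_entry perturbation_sym (ipC ip). Qed.

Lemma N_norm (v : 'cV[R]_n) : frob2 (N *m v) <= (alpha * g) ^+ 2 * frob2 v.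
Proof.
have f1 (w : 'cV[R]_n) : frob2 w = \sum_i w i 0 ^+ 2.
  by apply: eq_bigr => i _; rewrite big_ord1.
pose u := \sum_a v a 0 *: psi a.
have Pu : P u = u.
  rewrite P_expand; apply: eq_bigr => a _; congr (_ *: _).
  rewrite ip_sumr (bigD1 a) //= big1 => [|b ba];
    rewrite ipZr psi_orthonormal ?eqxx ?mulr1 ?addr0 //.
  by rewrite eq_sym (negPf ba) mulr0.
have u2 : `|u| ^+ 2 = frob2 v by rewrite (orthonormal_norm2 _ psi_orthonormal) f1.
have -> : frob2 (N *m v) = `|P (E u)| ^+ 2.
  rewrite f1 P_norm2; apply: eq_bigr => i _; rewrite -perturbation_sym mxE ip_sumr.
  by congr (_ ^+ 2); apply: eq_bigr => a _; rewrite N_entry ipZr mulrC.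
rewrite -u2 -exprMn ler_pXn2r ?nnegrE ?mulr_ge0 ?alpha_ge0 //; last exact: ltW.
apply: le_trans (P_E_le u) _; have := W_P_le u; rewrite Pu => Wu.
rewrite -[X in _ * X * `|u|]sqrt_gap_sqr expr2 !mulrA -[leRHS]mulrA.
by rewrite ler_wpM2l // mulr_ge0 ?alpha_ge0 ?sqrtr_ge0.
Qed.

(** Both K Lamh and the product of Lam + N with K come from <Ah psi_i, psih_a>: the
    first is the eigenvector equation of psih_a, the second sees only P psih_a. *)
Lemma residual_entry i a :
  (K *m diag_mx lamhr - (diag_mx lamr + N) *m K) i a = ip (E (psi i)) (tilt a).
Proof.
have NK : (N *m K) i a = ip (E (psi i)) (P (psih a)).
  rewrite P_expand ip_sumr mxE; apply: eq_bigr => b _.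
  by rewrite N_entry ipZr mulrC [K b a]mxE.
have -> : (K *m diag_mx lamhr - (diag_mx lamr + N) *m K) i a =
    K i a * lamhr 0 a - (lamr 0 i * K i a + (N *m K) i a).
  have mB (X Y Z : 'M[R]_n) : (X - (Y + Z)) i a = X i a - (Y i a + Z i a).
    by rewrite !mxE.
  rewrite mulmxDl mB mul_mx_diag mul_diag_mx.
  by rewrite [X in X - _]mxE [X in _ - (X + _)]mxE.
have [_ _ _ ev _] := HS; have [_ _ _ evh _] := HSh.
have Ahp : ip (Ah (psi i)) (psih a) = lamhr 0 a * K i a.
  by rewrite sAh evh ?ipZr ?mxE //; exact: Jh_idx (elt_mem a).
have Ap : ip (A (psi i)) (psih a) = lamr 0 i * K i a.
  by rewrite ev ?ipZl ?mxE //; exact: J_idx (elt_mem i).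
have -> : ip (E (psi i)) (tilt a) =
    lamhr 0 a * K i a - lamr 0 i * K i a - ip (E (psi i)) (P (psih a)).
  by rewrite -Ahp -Ap -ipBl -ipBr.
rewrite NK; ring.
Qed.

Lemma residual_beta :
  frob (K *m diag_mx lamhr - (diag_mx lamr + N) *m K) <= 2 * g * beta ^+ 2.
Proof.
have gb0 : 0 <= 2 * g * beta ^+ 2.
  exact: mulr_ge0 (mulr_ge0 (ler0n _ 2) (ltW gap_gt0)) (sqr_ge0 _).
rewrite frob_le //.
rewrite (_ : (2 * g * beta ^+ 2) ^+ 2 = (g * beta ^+ 2) * (4 * (g * beta ^+ 2)));
  last by ring.
apply: (@le_trans _ _ (g * beta ^+ 2 * \sum_a `|W (tilt a)| ^+ 2)); last first.
  by rewrite ler_wpM2l ?weighted_tilt_hs // mulr_ge0 ?sqr_ge0 // ltW.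
rewrite -hs_norm_betaJ mulr_suml; apply: ler_sum => i _; rewrite mulr_sumr.
apply: ler_sum => a _; rewrite residual_entry -ip_R_W -exprMn.
rewrite -real_normK ?num_real // ler_pXn2r ?nnegrE ?mulr_ge0 //.
exact: ip_CauchySchwarz.
Qed.

Lemma residual_alpha_beta :
  frob (K *m diag_mx lamhr - (diag_mx lamr + N) *m K) <= 2 * g * alpha * beta.
Proof.
have ab0 : 0 <= 2 * g * alpha * beta.
  apply: mulr_ge0 beta_ge0; apply: mulr_ge0 alpha_ge0.
  exact: mulr_ge0 (ler0n _ 2) (ltW gap_gt0).
rewrite frob_le //.
have -> : (2 * g * alpha * beta) ^+ 2 =
    (alpha * Num.sqrt g) ^+ 2 * (4 * (g * beta ^+ 2)).
  by rewrite (exprMn 2 alpha (Num.sqrt g)) sqrt_gap_sqr; ring.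
apply: le_trans (ler_wpM2l (sqr_ge0 _) weighted_tilt_hs).
rewrite /frob2 exchange_big mulr_sumr; apply: ler_sum => a _ /=.
under eq_bigr do rewrite residual_entry perturbation_sym.
rewrite -P_norm2 -exprMn ler_pXn2r ?nnegrE ?mulr_ge0 ?alpha_ge0 ?sqrtr_ge0 //.
exact: P_E_le.
Qed.

Lemma defect_entry a b : (1%:M - K^T *m K) a b = ip (tilt a) (tilt b).
Proof.
have -> : (1%:M - K^T *m K) a b = (a == b)%:R - ip (P (psih a)) (psih b).
  rewrite !mxE P_expand ip_suml; congr (_ - _); apply: eq_bigr => i _.
  by rewrite !mxE ipZl.
rewrite -psih_orthonormal /tilt /specproj_compl ipBl !ipBr.
rewrite (P_sym _ (P _)) PP (P_sym _ (psih b)); ring.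
Qed.

Lemma defect_beta : frob (1%:M - K^T *m K) <= 4 * beta ^+ 2.
Proof.
have s0 : 0 <= \sum_a `|tilt a| ^+ 2 by apply: sumr_ge0 => a _; exact: sqr_ge0.
apply: le_trans tilt_hs; rewrite frob_le // expr2 mulr_suml.
apply: ler_sum => a _; rewrite mulr_sumr; apply: ler_sum => b _.
rewrite defect_entry -exprMn -real_normK ?num_real //.
by rewrite ler_pXn2r ?nnegrE ?mulr_ge0 // ip_CauchySchwarz.
Qed.

(** A row of the Gram matrix is tested against the combination of the tilts that has
    this row as coefficients. *)
Lemma defect_op_beta (tau : R) : 0 <= tau ->
  (forall v : 'I_n -> R, `|\sum_a v a *: tilt a| <= tau * Num.sqrt (\sum_a v a ^+ 2)) ->
  frob (1%:M - K^T *m K) <= 2 * tau * beta.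
Proof.
move=> tau0 yop; rewrite frob_le; last exact: mulr_ge0 (mulr_ge0 (ler0n _ 2) tau0) beta_ge0.
rewrite (_ : (2 * tau * beta) ^+ 2 = tau ^+ 2 * (4 * beta ^+ 2)); last by ring.
apply: le_trans (ler_wpM2l (sqr_ge0 _) tilt_hs).
rewrite mulr_sumr; apply: ler_sum => a _.
under eq_bigr do rewrite defect_entry.
set s := \sum_b _; have s0 : 0 <= s by apply: sumr_ge0 => b _; exact: sqr_ge0.
have sE : s = ip (tilt a) (\sum_b ip (tilt a) (tilt b) *: tilt b).
  by rewrite ip_sumr; apply: eq_bigr => b _; rewrite ipZr expr2.
have h : s <= `|tilt a| * (tau * Num.sqrt s).
  rewrite [leLHS]sE; apply: le_trans (ler_norm _) _.
  apply: le_trans (ip_CauchySchwarz Hip _ _) _.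
  by rewrite ler_wpM2l //; exact: yop.
have [->|sn0] := eqVneq s 0; first by rewrite mulr_ge0 ?sqr_ge0.
have sp : 0 < Num.sqrt s by rewrite sqrtr_gt0 lt_neqAle eq_sym sn0.
rewrite -[leLHS]sqr_sqrtr // -exprMn ler_pXn2r ?nnegrE ?mulr_ge0 ?sqrtr_ge0 //.
rewrite -(ler_pM2r sp) -expr2 sqr_sqrtr //; apply: le_trans h _.
by rewrite le_eqVlt; apply/orP; left; apply/eqP; ring.
Qed.

(** * The deviation bounds *)

Variables (V : 'M[R]_n) (nu : 'rV[R]_n) (c : R).
Hypotheses (VV : V *m V^T = 1%:M) (VN : V *m N = diag_mx nu *m V).
Hypothesis nu_dec : forall i j : 'I_n, (i <= j)%N -> nu 0 j <= nu 0 i.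
Hypothesis J_sorted : sorted ltn J.
Local Notation m := (max_dev S J c).

Lemma lam_dev a : `|lamr 0 a - c| <= m.
Proof.
rewrite mxE /max_dev.
have lm : lam (inl (elt a)) \in distinct_eigvals S J.
  by rewrite mem_sort mem_undup; apply/mapP; exists (elt a); rewrite ?elt_mem.
exact: (@Order.TotalTheory.le_bigmax_seq _ _ _ _ 0 _ xpredT (fun t => `|t - c|) lm isT).
Qed.

Lemma max_dev_ge0 : 0 <= m.
Proof. by rewrite /max_dev; elim/big_ind: _ => // p q p0 q0; rewrite le_max p0. Qed.

Lemma lamh_dev a : `|lamhr 0 a - c| <= m + alpha * g.
Proof.
have := weyl (elt_mem a); have := lam_dev a; rewrite ![_ 0 a]mxE => h1 h2.
have := ler_normD (lamh (inl (elt a)) - lam (inl (elt a))) (lam (inl (elt a)) - c).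
by rewrite addrA subrK; lra.
Qed.

Lemma lamhr_dec (i j : 'I_n) : (i <= j)%N -> lamhr 0 j <= lamhr 0 i.
Proof.
have [mono _ _ _ _] := HSh => ij; rewrite !mxE; apply: (mono _ _ _ _).2.
  2: exact: Jh_idx (elt_mem j).
move: ij; rewrite leq_eqVlt => /predU1P[/val_inj -> //|ij].
by apply: ltnW; apply: (sorted_ltn_nth ltn_trans) => //; rewrite inE.
Qed.

Lemma deviation_bound f h :
  frob (K *m diag_mx lamhr - (diag_mx lamr + N) *m K) <= f ->
  frob (1%:M - K^T *m K) <= h ->
  Num.sqrt (\sum_i (lamhr 0 i - c - nu 0 i) ^+ 2) <=
    f + 2 * (m + alpha * g) * h + Num.sqrt (\sum_i (lamr 0 i - c) ^+ 2).
Proof.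
apply: (eigenvalues_near_compression VV VN nu_dec lamhr_dec max_dev_ge0 _
  lam_dev lamh_dev N_norm).
by rewrite mulr_ge0 ?alpha_ge0 // ltW.
Qed.

Lemma deviation_le_beta_sqr : Num.sqrt (\sum_i (lamhr 0 i - c - nu 0 i) ^+ 2) <=
  ((3 + Num.sqrt 2) * g + (4 * Num.sqrt 2 + 4) * m) * beta ^+ 2 +
  Num.sqrt (\sum_i (lamr 0 i - c) ^+ 2).
Proof.
apply: le_trans (deviation_bound residual_beta defect_beta) _; rewrite lerD2r.
have q1 : 1 <= Num.sqrt 2 :> R by rewrite -[leLHS]sqrtr1 ler_wsqrtr // ler1n.
have gb : 0 <= g * beta ^+ 2 := mulr_ge0 (ltW gap_gt0) (sqr_ge0 _).
have mb : 0 <= m * beta ^+ 2 := mulr_ge0 max_dev_ge0 (sqr_ge0 _).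
have h1 : alpha * (g * beta ^+ 2) <= 1 / 4 * (g * beta ^+ 2) by rewrite ler_wpM2r.
have h2 : 1 * (g * beta ^+ 2) <= Num.sqrt 2 * (g * beta ^+ 2) by rewrite ler_wpM2r.
have h3 : 1 * (m * beta ^+ 2) <= Num.sqrt 2 * (m * beta ^+ 2) by rewrite ler_wpM2r.
lra.
Qed.

Lemma deviation_le_alpha_beta : Num.sqrt (\sum_i (lamhr 0 i - c - nu 0 i) ^+ 2) <=
  ((56 * Num.sqrt (2 * D) / 9 * alpha + 4) * g
   + 56 * (Num.sqrt 2 + 1) * Num.sqrt D / 9 * m) * alpha * beta +
  Num.sqrt (\sum_i (lamr 0 i - c) ^+ 2).
Proof.
have a0 := alpha_ge0; have s0 : 0 <= Num.sqrt D := sqrtr_ge0 _.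
have t0 : 0 <= 8 / 3 * alpha * Num.sqrt D by rewrite !mulr_ge0.
have b1 := deviation_bound residual_alpha_beta (defect_op_beta ler01 tilt_op_le1).
have b2 := deviation_bound residual_alpha_beta (defect_op_beta t0 tilt_op_le_alpha).
have q2 : 1410 / 1000 <= Num.sqrt 2 :> R.
  have h : 0 <= 1410 / 1000 :> R by lra.
  by rewrite -[leLHS](ger0_norm h) -sqrtr_sqr ler_wsqrtr //; lra.
rewrite sqrtrM //.
have agb : 0 <= alpha * g * beta := mulr_ge0 (mulr_ge0 a0 (ltW gap_gt0)) beta_ge0.
have mab : 0 <= m * alpha * beta := mulr_ge0 (mulr_ge0 max_dev_ge0 a0) beta_ge0.
have mb : 0 <= m * beta := mulr_ge0 max_dev_ge0 beta_ge0.
move: b1 b2; set rest := Num.sqrt (\sum_i (lamr 0 i - c) ^+ 2).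
set s := Num.sqrt D; set q : R := Num.sqrt 2; move=> b1 b2.
have sa0 : 0 <= s * alpha by rewrite mulr_ge0.
have qs : 1410 / 1000 * (s * alpha * (alpha * g * beta)) <=
    q * (s * alpha * (alpha * g * beta)) by rewrite ler_wpM2r // mulr_ge0.
have qm : 1410 / 1000 * (s * (m * alpha * beta)) <= q * (s * (m * alpha * beta)).
  by rewrite ler_wpM2r // mulr_ge0.
have ms0 : 0 <= s * (m * alpha * beta) by rewrite mulr_ge0.
(* 3/8 is where the two bounds tau = 1 and tau = (8/3) alpha sqrt D coincide. *)
have [big|small] := leP (3 / 8) (s * alpha).
  apply: le_trans b1 _; rewrite lerD2r.
  have h1 : 3 / 8 * (alpha * g * beta) <= s * alpha * (alpha * g * beta) by rewrite ler_wpM2r.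
  have h2 : 3 / 8 * (m * beta) <= s * alpha * (m * beta) by rewrite ler_wpM2r.
  lra.
apply: le_trans b2 _; rewrite lerD2r.
have h1 : s * alpha * (alpha * g * beta) <= 3 / 8 * (alpha * g * beta).
  by rewrite ler_wpM2r // ltW.
lra.
Qed.

End Aligned.
End Perturbation.

Theorem theorem3p13 (R : realType) (H : completeNormedModType R)
    (ip : {dot H for idfun}) (Hip : norm_from ip) (Hsep : separable_space H)
    (A Ah : {linear H -> H})
    (cA : compact_operator A) (sA : selfadjoint ip A) (pA : nonneg_eigenvalues A)
    (cAh : compact_operator Ah) (sAh : selfadjoint ip Ah)
    (pAh : nonneg_eigenvalues Ah)
    (S Sh : eigensystem H)
    (HS : eigensystem_of ip A S) (HSh : eigensystem_of ip Ah Sh)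
    (J : seq nat) (J_incr : sorted ltn J) (J_nonempty : J <> [::])
    (J_idx : forall k : nat, k \in J -> idx S (inl k) /\ idx Sh (inl k))
    (gap_gt0 : 0 < gap S J)
    (Halpha : alphaJ ip A Ah S J <= 1 / 4)
    (c : R) :
  let g := gap S J in
  let alpha := alphaJ ip A Ah S J in
  let beta := betaJ ip A Ah S J in
  let D : R := (size (distinct_eigvals S J))%:R in
  let m := max_dev S J c in
  norm2 (shifted_eigvals Sh J c - spec_down (compression ip (Ah \- A) S J))
  <= Num.min
       (((56 * Num.sqrt (2 * D) / 9 * alpha + 4) * g
         + 56 * (Num.sqrt 2 + 1) * Num.sqrt D / 9 * m) * alpha * beta)
       (((3 + Num.sqrt 2) * g + (4 * Num.sqrt 2 + 4) * m) * beta ^+ 2)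
     + norm2 (shifted_eigvals S J c).
Proof.
lazy zeta.
have J_uniq : uniq J by apply: sorted_uniq J_incr => //; [exact: ltn_trans|exact: ltnn].
have J1 k : k \in J -> idx S (inl k) by move=> /J_idx[].
have J2 k : k \in J -> idx Sh (inl k) by move=> /J_idx[].
have [V [VV VN nu_dec]] := spec_down_diagonalizes (N_sym sA sAh S J).
rewrite -lerBlDr le_min !lerBlDr.
have -> : norm2 (shifted_eigvals Sh J c - spec_down (compression ip (Ah \- A) S J)) =
    Num.sqrt (\sum_i ((\row_(a < size J) eigval Sh (inl (nth 0%N J a))) 0 i - c
      - spec_down (compression ip (Ah \- A) S J) 0 i) ^+ 2).
  congr Num.sqrt; apply: eq_bigr => i _; congr (_ ^+ 2).
  by rewrite !mxE.
have -> : norm2 (shifted_eigvals S J c) =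
    Num.sqrt (\sum_i ((\row_(a < size J) eigval S (inl (nth 0%N J a))) 0 i - c) ^+ 2).
  by congr Num.sqrt; apply: eq_bigr => i _; rewrite !mxE.
apply/andP; split.
  exact: (deviation_le_alpha_beta Hip cA sA cAh sAh HS J_uniq J_nonempty J1 gap_gt0 pA pAh HSh
    J2 Halpha c VV VN nu_dec J_incr).
exact: (deviation_le_beta_sqr Hip cA sA cAh sAh HS J_uniq J_nonempty J1 gap_gt0 pA pAh HSh
    J2 Halpha c VV VN nu_dec J_incr).
Qed.
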